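(* Let $n\ge 1$. For every maximal rook placement $\rho$ on the board $B_n$, the word $\alpha(\rho)$ defined below is a parking function, and the composition $R\mapsto \omega(\alpha(\rho(R)))$ is a bijection from the set of regions of the Ish arrangement $\mathsf{Ish}(n)$ to the set of regions of the Shi arrangement $\mathsf{Shi}(n)$.
   Context: Notation: $[n]=\{1,\dots,n\}$; $\mathfrak S_n$ is the symmetric group, permutations written in one-line notation $\pi=\pi_1\cdots\pi_n$. In $\mathbb R^n$ with coordinates $x_1,\dots,x_n$, the Shi arrangement is $\mathsf{Shi}(n)=\{x_i-x_j=0:1\le i<j\le n\}\cup\{x_i-x_j=1:1\le i<j\le n\}$ and the Ish arrangement is $\mathsf{Ish}(n)=\{x_i-x_j=0:1\le i<j\le n\}\cup\{x_1-x_j=i:1\le i<j\le n\}$. A region is a connected component of the complement of the union of the hyperplanes. A hyperplane of the arrangement not through the origin is a ceiling of a region $R$ if it is the affine span of a facet (codimension-one face) of the closure of $R$ and does not separate $R$ from the origin. Parking functions: a word $w_1\cdots w_n\in[n]^n$ is a parking function if its nondecreasing rearrangement $a_1\le\dots\le a_n$ satisfies $a_i\le i$ for all $i$; $\mathsf{Park}_n$ is the set of them. The cyclic group $\mathbb Z_{n+1}$ acts on $[n+1]^n$ by $w_1\cdots w_n\mapsto (w_1+1)\cdots(w_n+1)$ with letters taken modulo $n+1$ (in $\{1,\dots,n+1\}$); each orbit contains exactly one parking function. The map $\omega$: for a region $R$ of $\mathsf{Shi}(n)$, let $\pi\in\mathfrak S_n$ be such that $x_{\pi_1}>\dots>x_{\pi_n}$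 on $R$, let $\Pi$ be the set partition of $[n]$ generated by $a\sim b$ whenever $x_{\pi_a}-x_{\pi_b}=1$ is a ceiling of $R$, and define $w(R)=w_1\cdots w_n$ by letting $w_i$ be the smallest element of the block of $\Pi$ containing $\pi^{-1}(i)$ (the position of $i$ in $\pi$). It is known that $R\mapsto w(R)$ is a bijection from regions of $\mathsf{Shi}(n)$ onto $\mathsf{Park}_n$; $\omega:\mathsf{Park}_n\to\{\text{regions of }\mathsf{Shi}(n)\}$ denotes its inverse. Ish ceiling diagram: for a region $R$ of $\mathsf{Ish}(n)$, let $\pi\in\mathfrak S_n$ be such that $x_{\pi_1}>\dots>x_{\pi_n}$ on $R$, and let $\epsilon_j=i$ if $x_1-x_{\pi_j}=i$ is a ceiling of $R$ and $\epsilon_j=0$ otherwise. Boards and rooks: $B_n=\{(i,j)\in\mathbb Z^2: 2\le i\le n,\ 1\le j\le n+i-1\}$; $i$ is the column and $j$ the row (height). A rook placement is a set of squares of the board with no two in the same row or column; it is maximal if it is maximal under inclusion among rook placements on the board. For a region $R$ of $\mathsf{Ish}(n)$ with Ish ceiling diagram $(\pi,\epsilon)$, $\rho(R)$ is the rook placement on $B_n$ having, for each $2\le i\le n$, one rook in column $i$: at $(i,\pi^{-1}(i))$ if $\epsilon_{\pi^{-1}(i)}=0$, and at $(i,n+\epsilon_{\pi^{-1}(i)})$ if $\epsilon_{\pi^{-1}(i)}>0$. The map $\alpha$: for a maximal rook placement $\rho$ on $B_n$ with a rook in row $r_i$ of column $i$ for each $2\le i\le n$, fire a laser rightward from each rook,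 so that the laser squares in column $i$ are the rows $r_j$ with $2\le j<i$. Define $v_1=1$ and, for $2\le i\le n$, $v_i$ = the number of squares of column $i$ weakly below the rook of column $i$ which contain no laser, i.e. $v_i=r_i-\#\{2\le j<i: r_j<r_i\}$. Then $v_1\cdots v_n\in[n+1]^n$, and $\alpha(\rho)$ is the unique parking function in the $\mathbb Z_{n+1}$-orbit of $v_1\cdots v_n$. *)

(* Defs.v *)
From HB Require Import structures.
From mathcomp Require Import all_boot all_order all_algebra all_fingroup.
From mathcomp Require Import all_classical all_reals all_analysis.
Import Order.TTheory GRing.Theory Num.Theory numFieldNormedType.Exports.

Set Implicit Arguments.
Unset Strict Implicit.
Unset Printing Implicit Defensive.

Local Open Scope classical_set_scope.
Local Open Scope ring_scope.

(* The coordinates x_1, ..., x_n are indexed by 'I_n: the label i in [n] is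
   the ordinal of value i - 1. Positions in words and permutations follow the
   same convention, while letters of words and coordinates of squares are the
   1-based natural numbers themselves. *)

Section Geometry.
Context {R : realType} {n : nat}.
Implicit Types (c x : 'rV[R]_n) (d : R) (P F S D H : set 'rV[R]_n).
Implicit Types A : set (set 'rV[R]_n).

Definition dotp c x : R := \sum_(i < n) c ord0 i * x ord0 i.

Definition level_set c d : set 'rV[R]_n := [set x | dotp c x = d].

Definition affine_span S : set 'rV[R]_n :=
  [set x | exists k (s : 'I_k -> 'rV[R]_n) (t : 'I_k -> R),
     [/\ forall i, S (s i), \sum_i t i = 1 & x = \sum_i t i *: s i]].

Definition face P F : Prop :=
  exists c d, P `<=` [set x | dotp c x <= d] /\ F = P `&` level_set c d.

(* The affine subspaces of codimension one are the level sets of the nonzero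
   linear forms; the closure of a region is full-dimensional, so that its
   codimension-one faces are those of codimension one in the whole space. *)
Definition facet P F : Prop :=
  face P F /\ exists c d, c != 0 /\ affine_span F = level_set c d.

Definition regions A : set (set 'rV[R]_n) :=
  let U := ~` \bigcup_(H in A) H in [set connected_component U x | x in U].

(* No sign condition is needed: (c, d) may be replaced by (- c, - d). *)
Definition separates H D x : Prop :=
  exists c d, [/\ H = level_set c d,
    forall y, D y -> dotp c y < d & d < dotp c x].

Definition ceiling A D H : Prop :=
  [/\ A H, ~ H 0, exists2 F, facet (closure D) F & affine_span F = H
    & ~ separates H D 0].

Definition diff_hyp (i j : 'I_n) d : set 'rV[R]_n :=
  [set x | x ord0 i - x ord0 j = d].

Definition region_perm D : {perm 'I_n} :=
  xget 1%g [set p : {perm 'I_n} | forall x, D x ->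
    forall a b : 'I_n, (a < b)%N -> x ord0 (p b) < x ord0 (p a)].

End Geometry.

Definition Shi (R : realType) (n : nat) : set (set 'rV[R]_n) :=
  [set H | exists i j : 'I_n,
    (i < j)%N /\ (H = diff_hyp i j 0 \/ H = diff_hyp i j 1)].

(* [o] is the index of the first coordinate x_1, and [i.+1] is the label of
   [i : 'I_n]. *)
Definition Ish (R : realType) (n : nat) : set (set 'rV[R]_n) :=
  [set H | exists o i j : 'I_n, [/\ o = 0%N :> nat, (i < j)%N
    & H = diff_hyp i j 0 \/ H = diff_hyp o j i.+1%:R]].

Arguments Shi : clear implicits.
Arguments Ish : clear implicits.

Section Parking.
Context {n : nat}.
Implicit Types w p : {ffun 'I_n -> nat}.

Definition parking w : Prop :=
  (forall i, 1 <= w i <= n)%N /\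
  (forall i : 'I_n, nth 0%N (sort leq (codom w)) i <= i.+1)%N.

(* Addition of 1 to the letters, modulo n + 1 in {1, ..., n + 1}. *)
Definition shift w : {ffun 'I_n -> nat} := [ffun i => (w i %% n.+1).+1].

Definition orbit_shift w : set {ffun 'I_n -> nat} :=
  [set p | exists k, p = iter k shift w].

End Parking.

Section Omega.
Context {R : realType} {n : nat}.
Implicit Type D : set 'rV[R]_n.

Definition shi_link D (a b : 'I_n) : bool :=
  `[< ceiling (Shi R n) D
        (diff_hyp (region_perm D a) (region_perm D b) 1) >].

Definition shi_partition D : {set {set 'I_n}} :=
  equivalence_partition
    (connect (fun a b => shi_link D a b || shi_link D b a)) [set: 'I_n]%SET.

Definition shi_word D : {ffun 'I_n -> nat} :=
  [ffun i => let a := (region_perm D)^-1%g i in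
     [arg min_(b < a in finset.pblock (shi_partition D) a) (b : nat)]%N.+1].

Definition omega : {ffun 'I_n -> nat} -> set 'rV[R]_n :=
  'pinv_(fun=> set0) (regions (Shi R n)) shi_word.

End Omega.

(* [(i, j) : square n] is the square in column i and row j; the types are
   large enough for the squares of the board. *)
Definition square (n : nat) : finType := ('I_n.+1 * 'I_n.*2)%type.

Definition board (n : nat) : {set square n} :=
  [set s : square n | (2 <= s.1 <= n)%N && (1 <= s.2 <= n + s.1 - 1)%N]%SET.

Section Rooks.
Context {n : nat}.
Implicit Type rho : {set square n}.

Definition rook_placement rho : bool :=
  (rho \subset board n) &&
  [forall s in rho, forall t in rho,
     (s != t) ==> (s.1 != t.1) && (s.2 != t.2)].

Definition maximal_rook_placement rho : bool := maxset rook_placement rho.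

Definition lasered rho (s : square n) : bool :=
  [exists t in rho, (t.1 < s.1)%N && (t.2 == s.2)].

Definition rook_word rho : {ffun 'I_n -> nat} :=
  [ffun k : 'I_n => if k == 0%N :> nat then 1%N else
     #|[set s in board n | [&& s.1 == k.+1 :> nat, ~~ lasered rho s
          & [exists t in rho, (t.1 == s.1) && (s.2 <= t.2)%N]]]%SET|].

(* The default value lies in the orbit, so that [alpha rho] is a parking
   function exactly when the orbit of [rook_word rho] contains one. *)
Definition alpha rho : {ffun 'I_n -> nat} :=
  xget (rook_word rho) [set p | parking p /\ orbit_shift (rook_word rho) p].

End Rooks.

Section IshRooks.
Context {R : realType} {n : nat}.
Implicit Type D : set 'rV[R]_n.

Definition ish_eps D (j : 'I_n) : nat :=
  xget 0%N [set i : nat | exists2 o : 'I_n, o = 0%N :> nat &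
    ceiling (Ish R n) D (diff_hyp o (region_perm D j) i%:R)].

Definition ish_rooks D : {set square n} :=
  [set s : square n | [exists i : 'I_n,
     let j := (region_perm D)^-1%g i in
     [&& (0 < i)%N, s.1 == i.+1 :> nat
       & s.2 == (if ish_eps D j == 0%N then j.+1 else n + ish_eps D j)%N
           :> nat]]]%SET.

End IshRooks.

(* Main.v *)
(** The regions of an arrangement of hyperplanes x_i - x_j = k are its sign
    cells, and x_i - x_j = k > 0 is a ceiling of a cell exactly when some point
    of the hyperplane lies on the side of the cell with respect to every other
    hyperplane.

    For Shi(n), order the coordinates of a region decreasingly; the ceilings
    are then the maximal pairs of positions a < b with labels in increasing
    order whose coordinates differ by less than 1. They form a nonnesting set
    of arcs, any such set occurs, and it determines the region.  The elements
    of a nonnesting block structure are served first in, first out, so a word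
    recording the first position of each block determines labels and arcs
    position by position; the queue never runs dry precisely for parking
    functions.

    For Ish(n), a region is determined by its permutation and the ceiling
    levels, which are nonzero only right of x_1 and increase with the position;
    hence a rook row at most n fixes the position of a label, and the remaining
    labels fill the free positions in the order of their levels.

    On the board, the rook word is an arbitrary word over [n+1] with first
    letter 1, because the earlier rooks leave n + 1 free rows in each column,
    and by the cycle lemma such words and parking functions both represent each
    shift orbit exactly once. *)
Require Import Defs.
From mathcomp Require Import all_boot all_order all_algebra all_fingroup.
From mathcomp Require Import all_classical all_reals all_analysis.
From mathcomp Require Import zify lra ring.
Import Order.TTheory GRing.Theory Num.Theory numFieldNormedType.Exports.

Set Implicit Arguments.
Unset Strict Implicit.
Unset Printing Implicit Defensive.

Local Open Scope classical_set_scope.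
Local Open Scope ring_scope.

(** * Regions and ceilings of an arrangement *)

Section Arrangement.
Context {R : realType} {n : nat}.
Implicit Types (x y z p : 'rV[R]_n) (i j : 'I_n) (t : R).

Definition dif x i j : R := x ord0 i - x ord0 j.

Definition line y z t : 'rV[R]_n := y + t *: (z - y).

Lemma dif_line y z t i j :
  dif (line y z t) i j = dif y i j + t * (dif z i j - dif y i j).
Proof. rewrite /dif /line !mxE; ring. Qed.

Lemma line0 y z : line y z 0 = y.
Proof. by rewrite /line scale0r addr0. Qed.

Lemma line1 y z : line y z 1 = z.
Proof. by rewrite /line scale1r addrC subrK. Qed.

Lemma line_continuous y z : continuous (line y z).
Proof.
move=> t; apply: cvgD; first exact: cvg_cst.
exact: scalel_continuous.
Qed.

Lemma dif_continuous i j : continuous (fun x => dif x i j).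
Proof.
move=> x.
have h l : (fun y : 'rV[R]_n => y ord0 l) @ x --> x ord0 l.
  exact: coord_continuous.
exact: cvgB (h i) (h j).
Qed.

(** The image of [C] under a coordinate difference is an interval, and it misses [t]. *)
Lemma connected_side (C : set 'rV[R]_n) i j t x y :
  connected C -> C x -> C y -> (forall z, C z -> dif z i j != t) ->
  dif x i j < t -> dif y i j < t.
Proof.
move=> cC Cx Cy Ct xt; rewrite ltNge; apply/negP => ty.
have : connected [set dif z i j | z in C].
  apply: connected_continuous_connected => //.
  exact/continuous_subspaceT/dif_continuous.
move=> /connected_intervalP /(_ (dif x i j) (dif y i j)) /(_ _ _ t) [].
- by exists x.
- by exists y.
- by rewrite ty ltW.
- by move=> z Cz zt; move: (Ct z Cz); rewrite zt eqxx.
Qed.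

Lemma diff_hypE i j t : diff_hyp i j t = [set x | dif x i j = t].
Proof. by []. Qed.

Definition dif_form i j : 'rV[R]_n := \row_l ((l == i)%:R - (l == j)%:R).

Lemma dotp_dif_form i j x : dotp (dif_form i j) x = dif x i j.
Proof.
rewrite /dotp; under eq_bigr => l _ do rewrite mxE mulrBl.
rewrite big_split /= sumrN (bigD1 i) //= [X in - X](bigD1 j) //= !eqxx !mul1r.
rewrite !big1 ?addr0 // => l /negPf ->; exact: mul0r.
Qed.

Lemma diff_hyp_level i j t : diff_hyp i j t = level_set (dif_form i j) t.
Proof. by apply/seteqP; split=> x; rewrite /level_set /= dotp_dif_form. Qed.

Lemma dif_form_neq0 i j : i != j -> dif_form i j != 0.
Proof.
move=> ij; apply/eqP => /rowP /(_ i); rewrite !mxE eqxx (negPf ij) subr0.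
by move/eqP; rewrite oner_eq0.
Qed.

Lemma dotp_line (c : 'rV[R]_n) y z t :
  dotp c (line y z t) = dotp c y + t * (dotp c z - dotp c y).
Proof.
rewrite /dotp -sumrB mulr_sumr -big_split /=; apply: eq_bigr => l _.
rewrite !mxE; ring.
Qed.

Lemma dif_delta l i j : dif (delta_mx ord0 l) i j = (i == l)%:R - (j == l)%:R.
Proof. by rewrite /dif !mxE eqxx. Qed.

(** Moving along a basis vector other than the [i]-th and [j]-th stays in the first hyperplane, so
    the second form involves these two coordinates only; one test point then fixes the offset up to
    orientation. *)
Lemma diff_hyp_sub i j i' j' t t' : i != j -> i' != j' ->
  diff_hyp i j t `<=` diff_hyp i' j' t' ->
  [/\ i' = i, j' = j & t' = t] \/ [/\ i' = j, j' = i & t' = - t].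
Proof.
move=> ij ij' sub.
have dp y l : dif (y + delta_mx ord0 l) =2
    fun a b => dif y a b + ((a == l)%:R - (b == l)%:R).
  by move=> a b; rewrite -dif_delta /dif !mxE; ring.
have dt l a b : dif (t *: delta_mx ord0 l) a b = t * ((a == l)%:R - (b == l)%:R).
  by rewrite -dif_delta /dif !mxE; ring.
have pH : dif (t *: delta_mx ord0 i) i j = t.
  by rewrite dt eqxx eq_sym (negPf ij) subr0 mulr1.
have sub' y : dif y i j = t -> dif y i' j' = t' := sub y.
have key l : l != i -> l != j -> (i' == l) = (j' == l).
  move=> li lj; have e := sub' _ pH.
  have := sub' (t *: delta_mx ord0 i + delta_mx ord0 l).
  rewrite !dp pH e ![_ == l]eq_sym (negPf li) (negPf lj) subr0 addr0.
  move=> /(_ erefl) /eqP; rewrite -subr_eq0 addrAC subrr add0r subr_eq0.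
  by case: (l == i'); case: (l == j') => //=; rewrite ?oner_eq0 // eq_sym oner_eq0.
have hi : i' = i \/ i' = j.
  case: (eqVneq i' i) => [|a]; first by left.
  case: (eqVneq i' j) => [|b]; first by right.
  by have := key _ a b; rewrite eqxx eq_sym (negPf ij').
have hj : j' = i \/ j' = j.
  case: (eqVneq j' i) => [|a]; first by left.
  case: (eqVneq j' j) => [|b]; first by right.
  by have := key _ a b; rewrite eqxx (negPf ij').
have := sub' _ pH; rewrite dt.
case: hi hj ij' => -> [] -> ; rewrite ?eqxx // => _.
  by rewrite [j == i]eq_sym (negPf ij) subr0 mulr1; left.
by rewrite [j == i]eq_sym (negPf ij) sub0r mulrN1; right.
Qed.

Lemma dif_sum k (s : 'I_k -> 'rV[R]_n) (c : 'I_k -> R) i j :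
  dif (\sum_l c l *: s l) i j = \sum_l c l * dif (s l) i j.
Proof.
rewrite /dif !summxE -sumrB; apply: eq_bigr => l _; rewrite !mxE; ring.
Qed.

Lemma affine_span_sub (F : set 'rV[R]_n) i j t :
  F `<=` diff_hyp i j t -> affine_span F `<=` diff_hyp i j t.
Proof.
move=> FH x [k [s [c [sF c1 ->]]]]; rewrite diff_hypE /= dif_sum.
under eq_bigr => l _ do rewrite (FH _ (sF l) : dif _ _ _ = _).
by rewrite -mulr_suml c1 mul1r.
Qed.

Lemma affine_span_line (F : set 'rV[R]_n) p y t : F p -> F y -> 
  affine_span F (line p y t).
Proof.
move=> Fp Fy; exists 2, (fun l => if l == ord0 then p else y),
  (fun l => if l == ord0 then 1 - t else t); split.
- by move=> l; case: ifP.
- by rewrite big_ord_recl big_ord1 /= subrK.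
- rewrite big_ord_recl big_ord1 /=; apply/rowP => l; rewrite !mxE; ring.
Qed.

End Arrangement.

(** A common form for the Shi and Ish arrangements, so that regions and ceilings are treated
    once. *)
Definition arrangement {R : realType} {n : nat} (E : 'I_n -> 'I_n -> nat -> bool) :
    set (set 'rV[R]_n) :=
  [set H | exists i j k, E i j k /\ H = diff_hyp i j k%:R].

(** * Sign cells, their closures and their ceilings *)

Section Cells.
Context {R : realType} {n : nat} (E : 'I_n -> 'I_n -> nat -> bool).
(** The order [i < j] fixes one orientation of each hyperplane, and the bound on [k] leaves finitely
    many triples to enumerate. *)
Hypothesis E_bound : forall i j k, E i j k -> (i < j)%N /\ (k <= n)%N.
Implicit Types (x y z p : 'rV[R]_n) (i j : 'I_n) (t : R) (k : nat).

Definition generic x := forall i j k, E i j k -> dif x i j != k%:R.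

Definition cell x : set 'rV[R]_n := [set y | forall i j k, E i j k ->
  dif y i j != k%:R /\ (dif y i j < k%:R) = (dif x i j < k%:R)].

(** For generic [x] this is the closure of the cell, see [closure_cell]. *)
Definition weak_cell x : set 'rV[R]_n := [set y | forall i j k, E i j k ->
  if dif x i j < k%:R then dif y i j <= k%:R else k%:R <= dif y i j].

Lemma E_neq i j k : E i j k -> i != j.
Proof. by move=> /E_bound[ij _]; rewrite -val_eqE /= neq_ltn ij. Qed.

Lemma cell_refl x : generic x -> cell x x.
Proof. by move=> gx i j k /gx. Qed.

Lemma cell_generic x y : cell x y -> generic y.
Proof. by move=> c i j k /c []. Qed.

Lemma cell_eq x y : cell x y -> cell x = cell y.
Proof.
move=> c; apply/seteqP; split=> z cz i j k Eijk; have [_ s] := c _ _ _ Eijk.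
  by rewrite s; exact: cz.
by rewrite -s; exact: cz.
Qed.

Lemma cell_weak x : cell x `<=` weak_cell x.
Proof.
move=> y c i j k /c [yk <-]; case: ltP => // kx; exact: ltW.
Qed.

Lemma weak_cell_line x y z t : weak_cell x y -> weak_cell x z -> 0 <= t <= 1 ->
  weak_cell x (line y z t).
Proof.
move=> cy cz /andP[t0 t1] i j k Eijk; rewrite dif_line.
by move: (cy _ _ _ Eijk) (cz _ _ _ Eijk); case: ifP => _ a b; nra.
Qed.

Lemma cell_line x y z t : weak_cell x y -> cell x z -> 0 < t <= 1 ->
  cell x (line y z t).
Proof.
move=> cy cz /andP[t0 t1] i j k Eijk; rewrite dif_line.
have [zk <-] := cz _ _ _ Eijk; move: (cy _ _ _ Eijk); have [_ <-] := cz _ _ _ Eijk.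
case: (ltrgtP (dif z i j) k%:R) zk => // zk _ yk.
  have lk : dif y i j + t * (dif z i j - dif y i j) < k%:R by nra.
  by rewrite lt_eqF.
have lk : k%:R < dif y i j + t * (dif z i j - dif y i j) by nra.
by rewrite gt_eqF // ltNge ltW.
Qed.

Lemma arrangement_complement :
  ~` (\bigcup_(H in arrangement E) H) = [set x : 'rV[R]_n | generic x].
Proof.
apply/seteqP; split=> x /=.
  move=> h i j k Eijk; apply/eqP => xk; apply: h.
  by exists (diff_hyp i j k%:R) => //; exists i, j, k.
by move=> gx [_ [i [j [k [Eijk ->]]]] xk]; have := gx _ _ _ Eijk; rewrite -xk eqxx.
Qed.

(** The component lies in the cell by [connected_side]; conversely the segment from [x] to a point
    of the cell is connected and meets no hyperplane. *)
Lemma connected_component_cell x : generic x ->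
  connected_component [set y | generic y] x = cell x.
Proof.
move=> gx; apply/seteqP; split=> y.
  move=> [C [Cx Cg cC] Cy] i j k Eijk; split; first exact: Cg.
  have Ct z : C z -> dif z i j != k%:R by move=> /Cg; apply.
  by apply/idP/idP; apply: (connected_side cC).
move=> cy; have cI : connected [set line x y t | t in `[(0:R), 1]].
  apply: connected_continuous_connected; first exact: segment_connected.
  exact/continuous_subspaceT/line_continuous.
apply: (connected_component_max _ _ cI).
- by exists 0; rewrite ?line0 //= in_itv /= lexx ler01.
- move=> _ [t tI <-]; move: tI; rewrite /= in_itv /= => /andP[t0 t1].
  have [->|tn] := eqVneq t 0; first by rewrite line0.
  apply: (@cell_generic x); apply: cell_line => //; last by rewrite lt_neqAle eq_sym tn t0.
  exact/cell_weak/cell_refl.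
- by exists 1; rewrite ?line1 //= in_itv /= lexx ler01.
Qed.

Lemma regions_arrangement :
  regions (arrangement E) = [set cell x | x in [set x | generic x]].
Proof.
rewrite /regions arrangement_complement; apply/seteqP; split=> _ [x gx <-];
  by exists x; rewrite // connected_component_cell.
Qed.

(** Weak inequalities survive limits; conversely the segment from a point of the weak cell towards
    [x] enters the cell at once. *)
Lemma closure_cell x : generic x -> closure (cell x) = weak_cell x.
Proof.
move=> gx; apply/seteqP; split=> z.
  move=> cz i j k Eijk.
  have cl (A : set R) : closed A -> cell x `<=` [set y | A (dif y i j)] -> A (dif z i j).
    move=> cA xA; have : closed [set y | A (dif y i j)].
      by apply: (preimage_closed (f := fun y => dif y i j)) => // y _; exact: dif_continuous.
    move=> /closure_id; move: (closureS xA cz) => + e; by rewrite -e.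
  case: ifP => xk.
    apply: (cl [set u | u <= k%:R]); first exact: closed_le.
    by move=> y /cell_weak /(_ _ _ _ Eijk); rewrite xk.
  apply: (cl [set u | k%:R <= u]); first exact: closed_ge.
  by move=> y /cell_weak /(_ _ _ _ Eijk); rewrite xk.
move=> wz B Bz.
have /nbhs_ballP[e /= e0 eB] : nbhs (0 : R) [set t | B (line z x t)].
  by apply: line_continuous; rewrite line0.
(* Time [e / 2] stays in the neighbourhood, and the cap at 1 stays on the segment. *)
have m0 : 0 < Num.min (e / 2) 1 by rewrite lt_min ltr01 divr_gt0.
exists (line z x (Num.min (e / 2) 1)); split.
  apply: cell_line => //; first exact: cell_refl.
  by rewrite m0 ge_min lexx orbT.
apply: eB; rewrite /ball /= sub0r normrN gtr0_norm // gt_min.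
by rewrite ltr_pdivrMr // ltr_pMr // ltr1n.
Qed.

(** For a triple of the arrangement, such a [p] lies in the relative interior of the facet that the
    cell of [x] has on this hyperplane. *)
Definition touches x i j k p := dif p i j = k%:R /\
  forall i' j' k', E i' j' k' -> (i', j', k') <> (i, j, k) ->
    dif p i' j' != k'%:R /\ (dif p i' j' < k'%:R) = (dif x i' j' < k'%:R).

(** A step of length [e] in direction [b] preserves the signs of the finitely many nonzero values
    [a]. *)
Lemma small_step (I : finType) (a b : I -> R) : (forall l, a l != 0) ->
  exists2 e, 0 < e & forall l, e * `|b l| < `|a l|.
Proof.
move=> a0; suff [e e0 he] : exists2 e, 0 < e &
    forall l, l \in enum I -> e * `|b l| < `|a l|.
  by exists e => // l; apply: he; rewrite mem_enum.
elim: (enum I) => [|l s [e e0 he]]; first by exists 1.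
have d0 : 0 < `|a l| / (`|b l| + 1) by rewrite divr_gt0 ?normr_gt0 ?ltr_wpDl.
have b1 : 0 < `|b l| + 1 by rewrite ltr_wpDl.
exists (Num.min e (`|a l| / (`|b l| + 1))); first by rewrite lt_min e0.
move=> l'; rewrite inE => /predU1P[->|/he h].
  apply: (@le_lt_trans _ _ (`|a l| / (`|b l| + 1) * `|b l|)).
    by rewrite ler_wpM2r // ge_min lexx orbT.
  by rewrite -mulrAC ltr_pdivrMr // ltr_pM2l ?normr_gt0 // ltrDl.
by apply: le_lt_trans h; rewrite ler_wpM2r // ge_min lexx.
Qed.

(** The cell is on the side of the origin, otherwise the ceiling would separate the two. The facet
    spans its hyperplane, so it leaves every other hyperplane somewhere; averaging such points, one
    hyperplane at a time, gives a point off all the others. *)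
Lemma ceiling_touches x i j k : generic x -> E i j k -> (0 < k)%N ->
  ceiling (arrangement E) (cell x) (diff_hyp i j k%:R) ->
  dif x i j < k%:R /\ exists p, touches x i j k p.
Proof.
move=> gx Eijk k0 [_ _ [F [[c [d [_ FE]]] _] affF] nsep]; split.
  rewrite ltNge; apply/negP => kx; have {}kx : k%:R < dif x i j.
    by rewrite lt_neqAle eq_sym gx.
  (* The form is reversed so that the cell lies on its smaller side. *)
  apply: nsep; exists (dif_form j i), (- k%:R); split.
  - rewrite -diff_hyp_level; apply/seteqP; split=> y; rewrite /diff_hyp /= => e; lra.
  - move=> y /(_ _ _ _ Eijk) [yk]; rewrite [in RHS]ltNge (ltW kx) /= => /negbT.
    by rewrite -leNgt le_eqVlt eq_sym (negPf yk) /= dotp_dif_form /dif => h; lra.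
  - by rewrite dotp_dif_form /dif !mxE subrr oppr_lt0 ltr0n.
have FH y : F y -> dif y i j = k%:R.
  move=> Fy; have : affine_span F y.
    by rewrite -(line0 y y); exact: affine_span_line.
  by rewrite affF.
have FW y : F y -> weak_cell x y.
  by rewrite FE -closure_cell // => -[].
suff [p [wp pH pn]] : exists p, [/\ weak_cell x p, dif p i j = k%:R &
    forall i' j' (k' : 'I_n.+1), (i', j', k') \in enum {: 'I_n * 'I_n * 'I_n.+1} ->
    E i' j' k' -> (i', j', k' : nat) <> (i, j, k) -> dif p i' j' != k'%:R].
  exists p; split=> // i' j' k' E' ne.
  have k'n : (k' < n.+1)%N by have [] := E_bound E'.
  have pk' := pn i' j' (Ordinal k'n) (mem_enum _ _) E' ne; split=> //.
  have := wp _ _ _ E'; case: ifP => _ h; first by rewrite lt_neqAle pk'.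
  by apply/negbTE; rewrite -leNgt.
elim: (enum _) => [|[[i' j'] k'] s [p [wp pH pn]]].
  (* The span of the facet is nonempty, and an affine combination has at least one term, so the
     facet has a point. *)
  have : affine_span F (k%:R *: delta_mx ord0 i).
    rewrite affF /diff_hyp /= !mxE !eqxx eq_sym (negPf (E_neq Eijk)) /=.
    by rewrite mulr0 mulr1 subr0.
  move=> [[|m] [u [t [uF t1 _]]]].
    by move: t1; rewrite big_ord0 => /esym/eqP; rewrite oner_eq0.
  by exists (u ord0); split=> //; [exact/FW/uF|exact/FH/uF].
have [[E' ne]|] := pselect (E i' j' k' /\ (i', j', k' : nat) <> (i, j, k)); last first.
  move=> h; exists p; split=> // i0 j0 l0; rewrite inE => /predU1P[[-> -> ->]|/pn//].
  by move=> E' ne; case: h.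
(* If the facet lay in this other hyperplane, so would its span, forcing equal triples because
   orientations are fixed. *)
have [q Fq qk] : exists2 q, F q & dif q i' j' != k'%:R.
  apply: contrapT => h; case: ne; have FH' : F `<=` diff_hyp i' j' k'%:R.
    move=> q Fq; apply/eqP/negPn/negP => qk; apply: h; exists q => //; exact: qk.
  move/affine_span_sub: FH'; rewrite affF => /diff_hyp_sub.
  move=> /(_ (E_neq Eijk) (E_neq E')) [[-> -> /eqP]|[ij' ji' _]].
    by rewrite eqr_nat => /eqP ->.
  have [lt1 _] := E_bound Eijk; have [lt2 _] := E_bound E'.
  by move: lt2; rewrite ij' ji' ltnNge ltnW.
have half : 0 <= (2^-1 : R) <= 1 by lra.
(* The midpoint is off every hyperplane that one of the endpoints avoids, since both are weakly on
   the same side. *)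
exists (line p q 2^-1); split.
- by apply: weak_cell_line => //; exact: FW.
- by rewrite dif_line pH (FH q Fq) subrr mulr0 addr0.
move=> i0 j0 l0 h E0 ne0; rewrite dif_line.
have := wp _ _ _ E0; have := FW _ Fq _ _ _ E0.
have strict : dif p i0 j0 != l0%:R \/ dif q i0 j0 != l0%:R.
  move: h; rewrite inE => /predU1P[[-> -> ->]|hs]; [by right|by left; exact: pn].
move: (dif p i0 j0) (dif q i0 j0) strict => a b ab.
by case: ifP => _ qa pa; apply/eqP => e; case: ab => /eqP; apply; lra.
Qed.

(** A small step from [p] towards any [y] of the hyperplane stays in the closed cell, and [y] is an
    affine combination of [p] and the point reached. *)
Lemma span_facet x i j k p : generic x -> E i j k -> dif x i j < k%:R ->
  touches x i j k p ->
  diff_hyp i j k%:R `<=`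
  affine_span (closure (cell x) `&` diff_hyp i j (k%:R : R)).
Proof.
move=> gx Eijk xk [pH pn] y yH; rewrite closure_cell //.
pose ok (l : 'I_n * 'I_n * 'I_n.+1) :=
  E l.1.1 l.1.2 l.2 && ((l.1.1, l.1.2, l.2 : nat) != (i, j, k)).
(* The distinguished triple and those outside [E] receive the value 1, since [small_step] asks for
   nonzero entries. *)
pose a l : R := if ok l then dif p l.1.1 l.1.2 - (l.2)%:R else 1.
pose b (l : 'I_n * 'I_n * 'I_n.+1) : R := dif y l.1.1 l.1.2 - dif p l.1.1 l.1.2.
have [|e e0 he] := @small_step _ a b.
  move=> l; rewrite /a; case: ifP => [/andP[E' /eqP ne]|_]; last exact: oner_neq0.
  by rewrite subr_eq0; have [] := pn _ _ _ E' ne.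
pose q := line p y e; have qH : dif q i j = k%:R.
  by rewrite dif_line pH (yH : dif _ _ _ = _) subrr mulr0 addr0.
have -> : y = line p q e^-1.
  by rewrite /q /line addrAC subrr add0r scalerA mulVf ?gt_eqF // scale1r addrC subrK.
apply: affine_span_line; split=> // i' j' k' E'.
  have [[-> -> ->]|ne] := pselect ((i', j', k') = (i, j, k)); first by rewrite xk pH.
  have [pk' <-] := pn _ _ _ E' ne.
  by case: ltP => // /ltW.
have [[-> -> ->]|ne] := pselect ((i', j', k') = (i, j, k)); first by rewrite xk qH.
have [pk' <-] := pn _ _ _ E' ne.
have k'n : (k' < n.+1)%N by have [] := E_bound E'.
have := he (i', j', Ordinal k'n); rewrite /a /ok /= E' /= ifT; last exact/eqP.
rewrite -(gtr0_norm e0) -normrM /b /= ltr_norml => /andP[h1 h2].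
have -> : dif q i' j' = dif p i' j' + e * (dif y i' j' - dif p i' j').
  exact: dif_line.
by case: ltP => c; move: h1 h2; [rewrite ltr0_norm|rewrite ger0_norm]; lra.
Qed.

(** By [span_facet] the closed cell meets the hyperplane in a facet; no separation occurs, because
    the difference is below [k] at [x] and at the origin alike. *)
Lemma touches_ceiling x i j k p : generic x -> E i j k -> (0 < k)%N ->
  dif x i j < k%:R -> touches x i j k p ->
  ceiling (arrangement E) (cell x) (diff_hyp i j k%:R).
Proof.
move=> gx Eijk k0 xk [pH pn]; set H := diff_hyp i j k%:R.
split; first by exists i, j, k.
- by rewrite /H /diff_hyp /= !mxE subrr => /esym/eqP; rewrite pnatr_eq0 -leqn0 leqNgt k0.
- have aff : affine_span (closure (cell x) `&` H) = H.
    rewrite /H eqEsubset; split.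
      by apply: affine_span_sub => y [_ yH].
    exact: (span_facet gx Eijk xk (conj pH pn)).
  exists (closure (cell x) `&` H); last exact: aff.
  split; exists (dif_form i j), k%:R; last first.
    by rewrite aff -diff_hyp_level; split=> //; exact: dif_form_neq0 (E_neq Eijk).
  rewrite -diff_hyp_level; split=> // y; rewrite closure_cell // => /(_ _ _ _ Eijk).
  by rewrite xk /= dotp_dif_form.
move=> [c [d [HE Dd d0]]]; have c0 : dotp c 0 = 0.
  by rewrite /dotp big1 // => l _; rewrite mxE mulr0.
rewrite c0 in d0; have cx := Dd _ (cell_refl gx).
(* [t] is where the segment from [x] to the origin would cross the separating level set; but the
   difference stays below [k] along this segment. *)
pose t := (d - dotp c x) / (dotp c 0 - dotp c x).
have dc : dotp c x != 0 by rewrite lt_eqF // (lt_trans cx d0).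
have tc : t * - dotp c x = d - dotp c x.
  by rewrite /t c0 sub0r divfK // oppr_eq0.
have : H (line x 0 t).
  by rewrite HE /level_set /= dotp_line c0 sub0r tc; lra.
rewrite /H diff_hypE /= dif_line [dif 0 _ _]/dif !mxE subrr => e.
have k0' : 0 < k%:R :> R by rewrite ltr0n.
have t0 : 0 < t by nra.
have t1 : t < 1 by nra.
nra.
Qed.

(** The segment from [x] to [y] meets this hyperplane alone, so the crossing point touches it. *)
Lemma ceiling_flip x i j k y : generic x -> E i j k -> (0 < k)%N ->
  dif x i j < k%:R -> k%:R < dif y i j ->
  (forall i' j' k', E i' j' k' -> (i', j', k') <> (i, j, k) ->
    dif y i' j' != k'%:R /\ (dif y i' j' < k'%:R) = (dif x i' j' < k'%:R)) ->
  ceiling (arrangement E) (cell x) (diff_hyp i j k%:R).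
Proof.
move=> gx Eijk k0 xk ky yn.
pose t := (k%:R - dif x i j) / (dif y i j - dif x i j).
have d0 : 0 < dif y i j - dif x i j by lra.
have te : t * (dif y i j - dif x i j) = k%:R - dif x i j by rewrite divfK ?gt_eqF.
have t0 : 0 < t by nra.
have t1 : t < 1 by nra.
apply: (@touches_ceiling _ _ _ _ (line x y t)) => //; split.
  by rewrite dif_line te; lra.
move=> i' j' k' E' ne; have [yk' s] := yn _ _ _ E' ne; have xk' := gx _ _ _ E'.
rewrite dif_line; move: (dif x i' j') (dif y i' j') s xk' yk' => a b s ak bk.
have [ka|ka] := ltP a k'%:R.
  have {s}bk' : b < k'%:R by rewrite s.
  have h : a + t * (b - a) < k'%:R by nra.
  by rewrite lt_eqF // h.
have {s}bk' : k'%:R < b.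
  by rewrite lt_neqAle eq_sym bk leNgt s -leNgt.
have {ak}ka' : k'%:R < a by rewrite lt_neqAle eq_sym ak.
have h : k'%:R < a + t * (b - a) by nra.
by rewrite gt_eqF // ltNge (ltW h).
Qed.

(** The hyperplane determines its triple: a positive offset excludes the reversed orientation, and
    also [i = j], where the set would be empty. *)
Lemma ceiling_mem D i j k : ceiling (arrangement E) D (diff_hyp i j (k%:R : R)) ->
  E i j k /\ (0 < k)%N.
Proof.
move=> [[i' [j' [k' [E' HE]]]] H0 _ _].
have k0 : (0 < k)%N.
  by rewrite lt0n; apply/eqP => k0; apply: H0; rewrite k0 /diff_hyp /= !mxE subrr.
split=> //; have pH : diff_hyp i' j' (k'%:R : R) (k'%:R *: delta_mx ord0 i').
  rewrite /diff_hyp /= !mxE !eqxx eq_sym (negPf (E_neq E')) /=.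
  by rewrite mulr0 mulr1 subr0.
have [ij|ij] := eqVneq i j.
  move: pH; rewrite -HE ij /diff_hyp /= subrr => /esym/eqP.
  by rewrite pnatr_eq0 -leqn0 leqNgt k0.
have [|[ii jj /eqP]|[ii jj /eqP]] := @diff_hyp_sub R n i j i' j' k%:R k'%:R ij (E_neq E').
- by rewrite HE.
- by rewrite eqr_nat => /eqP <-; rewrite -ii -jj.
by rewrite -subr_eq0 opprK -natrD pnatr_eq0 addn_eq0 -[k == _]leqn0 leqNgt k0 andbF.
Qed.

End Cells.

(** * Permutations sorting the coordinates *)

Section Sorting.
Context {R : realType} {n : nat}.
Implicit Types (x y : 'rV[R]_n) (p q : {perm 'I_n}) (i j : 'I_n).

Definition sorting x p := forall a b : 'I_n, (a < b)%N -> x ord0 (p b) < x ord0 (p a).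

Lemma sortingE x p (a b : 'I_n) : sorting x p ->
  (x ord0 (p b) < x ord0 (p a)) = (a < b)%N.
Proof.
move=> sx; apply/idP/idP => [|/sx //]; case: (ltngtP a b) => [//|/sx|/val_inj ->].
  by move=> h1 h2; move: (lt_trans h1 h2); rewrite ltxx.
by rewrite ltxx.
Qed.

Lemma sortingVE x p i j : sorting x p ->
  (x ord0 i < x ord0 j) = (p^-1%g j < p^-1%g i)%N.
Proof. by move=> sx; rewrite -[in LHS](permKV p i) -[in LHS](permKV p j) sortingE. Qed.

(** Positions are expressed through [x] alone, whence the uniqueness of the sorting permutation. *)
Lemma sorting_rank x p i : sorting x p ->
  (p^-1%g i : nat) = #|[set l | x ord0 i < x ord0 l]%SET|.
Proof.
move=> sx; set a := p^-1%g i.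
have -> : [set l | x ord0 i < x ord0 l]%SET = (p @: [set b : 'I_n | (b < a)%N])%SET.
  apply/setP => l; rewrite -[l](permKV p) mem_imset ?inE; last exact: perm_inj.
  by rewrite permKV (sortingVE _ _ sx).
rewrite card_imset; last exact: perm_inj.
by rewrite -sum1dep_card big_ord_narrow ?sum1_card ?card_ord // ltnW.
Qed.

Lemma sorting_inj x p q : sorting x p -> sorting x q -> p = q.
Proof.
move=> sp sq; apply: invg_inj; apply/permP => i; apply: val_inj.
by rewrite /= (sorting_rank _ sp) (sorting_rank _ sq).
Qed.

(** Distinct coordinates have distinct numbers of larger coordinates; this rank map is a permutation
    whose inverse sorts. *)
Lemma sorting_exists x : (forall i j, (i < j)%N -> dif x i j != 0) ->
  exists p, sorting x p.
Proof.
move=> x0; have x_inj i j : x ord0 i = x ord0 j -> i = j.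
  move=> e; apply: val_inj; case: (ltngtP i j) => // /x0;
    by rewrite /dif e subrr eqxx.
pose r i := [set l | x ord0 i < x ord0 l]%SET.
have rP i : (#|r i| < n)%N.
  rewrite -[X in (_ < X)%N]card_ord -cardsT; apply: proper_card.
  by apply/properP; split; [by apply/fintype.subsetP => l; rewrite inE|exists i; rewrite ?inE // ltxx].
have r_sub i j : x ord0 i < x ord0 j -> (#|r j| < #|r i|)%N.
  move=> ij; apply: proper_card; apply/properP; split.
    by apply/fintype.subsetP => l; rewrite !inE; exact: lt_trans.
  by exists j; rewrite !inE ?ltxx.
pose f i := Ordinal (rP i).
have f_inj : injective f.
  move=> i j [e]; apply: x_inj.
  by case: (ltgtP (x ord0 i) (x ord0 j)) => // /r_sub; rewrite e ltnn.
exists (perm f_inj)^-1%g => a b ab; rewrite ltNge le_eqVlt; apply/negP.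
have fK c : #|r ((perm f_inj)^-1%g c)| = c.
  by rewrite -[c in RHS](permKV (perm f_inj)) permE.
move=> /predU1P[/x_inj/perm_inj ab'|/r_sub].
  by move: ab; rewrite ab' ltnn.
by rewrite !fK ltnNge (ltnW ab).
Qed.

Variable E : 'I_n -> 'I_n -> nat -> bool.
Hypothesis E0 : forall i j, (i < j)%N -> E i j 0.

Lemma sorting_same x y p :
  (forall i j, (i < j)%N -> dif y i j != 0 /\ (dif y i j < 0) = (dif x i j < 0)) ->
  sorting x p -> sorting y p.
Proof.
move=> h sx a b ab; have := sx _ _ ab; rewrite -subr_lt0 -[y _ _ < _]subr_lt0.
case: (ltngtP (p a) (p b)) => [pab|pab|/val_inj/perm_inj e]; last first.
- by move: ab; rewrite e ltnn.
- by have [_] := h _ _ pab; rewrite /dif => ->.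
have [] := h _ _ pab; rewrite /dif => y0 s x0; rewrite -oppr_gt0 opprB lt_neqAle eq_sym y0.
by rewrite leNgt s -leNgt -oppr_le0 opprB ltW.
Qed.

Lemma cell_sorting x y p : cell E x y -> sorting x p -> sorting y p.
Proof. by move=> c; apply: sorting_same => i j /E0 /c. Qed.

Lemma region_perm_cell x p : generic E x -> sorting x p -> region_perm (cell E x) = p.
Proof.
move=> gx sx; rewrite /region_perm; case: xgetP => [q _ /(_ x (cell_refl gx)) sq|].
  exact: sorting_inj sq sx.
by move=> /(_ p) h; exfalso; apply: h => y cy; exact: cell_sorting cy sx.
Qed.

Lemma generic_sorting x : generic E x -> exists p, sorting x p.
Proof. by move=> gx; apply: sorting_exists => i j /E0 /gx. Qed.

End Sorting.

(** * Points on a line with prescribed short distances *)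

Section Realization.
Context {R : realFieldType}.

(** An ordered field is dense and unbounded, so finitely many bounds leave room. *)
Lemma between (ls us : seq R) : (forall l u, l \in ls -> u \in us -> l < u) ->
  exists z, (forall l, l \in ls -> l < z) /\ (forall u, u \in us -> z < u).
Proof.
have above (l : R) (vs : seq R) : (forall u, u \in vs -> l < u) ->
    exists2 w, l < w & forall u, u \in vs -> w < u.
  elim: vs => [|v vs IH] h; first by exists (l + 1); rewrite ?ltrDl.
  have [|w lw wv] := IH; first by move=> u uv; apply: h; rewrite inE uv orbT.
  have lv : l < v by apply: h; rewrite inE eqxx.
  exists (Num.min w ((l + v) / 2)); first by rewrite lt_min lw midf_lt.
  move=> u; rewrite inE => /predU1P[->|/wv]; last by move=> h1; rewrite gt_min h1.
  by rewrite gt_min midf_lt ?orbT.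
elim: ls => [|l ls IH] h.
  suff [z hz] : exists z, forall u, u \in us -> z < u by exists z.
  elim: us {h} => [|u us [z hz]]; first by exists 0.
  exists (Num.min z (u - 1)) => v; rewrite inE => /predU1P[->|/hz h].
    by rewrite gt_min ltrBlDr ltrDl ltr01 orbT.
  by rewrite gt_min h.
have [|z [z1 z2]] := IH; first by move=> a u al; apply: h; rewrite inE al orbT.
have [|w lw wu] := above l us; first by move=> u; apply: h; rewrite inE eqxx.
exists (Num.max z w); split=> [a|u uu]; last by rewrite gt_max z2 ?wu.
by rewrite inE => /predU1P[->|/z1 h1]; rewrite lt_max ?lw ?h1 ?orbT.
Qed.

(** Points are added one at a time, each below the previous ones. [T] prescribes the pairs closer
    than 1, and its monotonicity under shrinking intervals makes the constraints on the new point
    compatible. *)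
Lemma realize (T : nat -> nat -> bool) m :
  (forall a b a' b', T a b -> (a <= a')%N -> (b' <= b)%N -> T a' b') ->
  exists y : nat -> R, forall a b, (a < b < m)%N ->
    [/\ y b < y a, y a - y b != 1 & (y a - y b < 1) = T a b].
Proof.
move=> Tm; elim: m => [|m [y hy]]; first by exists (fun=> 0) => a b; rewrite ltn0 andbF.
(* The new point must exceed [ls] to be close where [T] asks for it, and stay below [us] to come
   last and be far elsewhere. *)
pose ls := [seq y a - 1 | a <- iota 0 m & T a m].
pose us := [seq y a | a <- iota 0 m] ++ [seq y a - 1 | a <- iota 0 m & ~~ T a m].
have [|z [z1 z2]] := @between ls us.
  move=> l u /mapP[a]; rewrite mem_filter mem_iota /= add0n => /andP[Ta am] ->.
  rewrite mem_cat => /orP[] /mapP[b].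
    rewrite mem_iota /= add0n => bm ->.
    case: (ltngtP a b) => [ab|ba|->].
    - have [|_ _ e] := hy a b; first by rewrite ab.
      have : T a b by apply: Tm Ta _ _ => //; exact: ltnW.
      by rewrite -e; lra.
    - have [|h _ _] := hy b a; first by rewrite ba.
      lra.
    - lra.
  rewrite mem_filter mem_iota /= add0n => /andP[Tb bm] ->.
  have ba : (b < a)%N by rewrite ltnNge; apply: contra Tb => ab; exact: Tm Ta ab _.
  have [|h _ _] := hy b a; first by rewrite ba.
  lra.
exists (fun a => if a == m then z else y a) => a b /andP[ab]; rewrite ltnS leq_eqVlt.
move=> /predU1P[bm|bm]; last first.
  rewrite !ltn_eqF //; last exact: ltn_trans bm.
  by apply: hy; rewrite ab.
have am : (a < m)%N by rewrite -bm.
rewrite bm eqxx ltn_eqF //.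
have za : z < y a by apply: z2; rewrite mem_cat map_f // mem_iota add0n.
have [Ta|Ta] := boolP (T a m).
  have h : y a - 1 < z by apply: z1; apply: map_f; rewrite mem_filter Ta mem_iota add0n.
  have h1 : y a - z < 1 by lra.
  by rewrite h1 lt_eqF.
have h : z < y a - 1.
  by apply: z2; rewrite mem_cat; apply/orP; right; apply: map_f; rewrite mem_filter Ta mem_iota add0n.
have h1 : 1 < y a - z by lra.
by rewrite gt_eqF // [_ < 1]ltNge (ltW h1).
Qed.

End Realization.

(** * Parking functions and nonnesting arcs *)

Section Diagrams.
Context {n : nat}.
Implicit Types (p : {perm 'I_n}) (A : rel 'I_n) (w : {ffun 'I_n -> nat}) (a b c l : 'I_n).

(** The second clause says that no arc is nested in another one; in particular two arcs share
    neither their left nor their right ends. *)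
Definition arcs p A :=
  (forall a b, A a b -> (a < b)%N /\ (p a < p b)%N) /\
  (forall a b a' b', A a b -> A a' b' -> (a <= a')%N -> (b' <= b)%N -> a = a' /\ b = b').

Definition opener A b := forall a, ~~ A a b.

(** The word [w] records for each label the 1-based first position of its block. *)
Definition diagram p A w := [/\ arcs p A,
  (forall a b, A a b -> w (p a) = w (p b)) &
  (forall b, opener A b -> w (p b) = b.+1)].

Lemma opener_or A b : opener A b \/ exists a, A a b.
Proof.
have [/existsP ?|] := boolP [exists a, A a b]; first by right.
by rewrite negb_exists => /forallP; left.
Qed.

(** Follow the arcs backwards to the first position of the block. *)
Lemma diagram_root p A w b : diagram p A w ->
  exists r : 'I_n, [/\ (r <= b)%N, opener A r, w (p r) = r.+1 & w (p b) = r.+1].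
Proof.
move=> [[A1 _] w1 w2]; have [m bm] := ubnP (b : nat); elim: m b bm => // m IH b bm.
have [ob|[a ab]] := opener_or A b; first by exists b; rewrite w2.
have [lab _] := A1 _ _ ab.
have [|r [rb ob w3 w4]] := IH a; first by apply: leq_trans lab _.
by exists r; split=> //; [exact: leq_trans rb (ltnW lab)|rewrite -(w1 _ _ ab)].
Qed.

Lemma diagram_word p A w w' : diagram p A w -> diagram p A w' -> w = w'.
Proof.
move=> [[A1 _] w1 w2] [_ w1' w2']; apply/ffunP => l; rewrite -[l](permKV p).
move: (p^-1%g l) => b; have [m bm] := ubnP (b : nat); elim: m b bm => // m IH b bm.
have [ob|[a ab]] := opener_or A b; first by rewrite w2 ?w2'.
rewrite -(w1 _ _ ab) -(w1' _ _ ab); apply: IH; have [lab _] := A1 _ _ ab.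
exact: leq_trans lab _.
Qed.

Lemma arcs_right p A a b b' : arcs p A -> A a b -> A a b' -> b = b'.
Proof.
move=> [_ A2] h h'; case: (leqP b' b) => bb; first by have [] := A2 _ _ _ _ h h' (leqnn _) bb.
by have [] := A2 _ _ _ _ h' h (leqnn _) (ltnW bb).
Qed.

Lemma diagram_le p A w b : diagram p A w -> (w (p b) <= b.+1)%N.
Proof. by move=> /(diagram_root b) [r [? _ _ ->]]. Qed.

(** Induction on [v]. The arc into [v] cannot start before [u]: by induction the arc leaving its
    source would then end at or before [u]. *)
Lemma diagram_chain p A w u v : diagram p A w -> w (p u) = w (p v) -> (u < v)%N ->
  (exists2 u', A u u' & (u' <= v)%N) /\ (p u < p v)%N.
Proof.
move=> d; have [[A1 A2] w1 w2] := d.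
have [m vm] := ubnP (v : nat); elim: m u v vm => // m IH u v vm uv lt_uv.
have [ov|[c cv]] := opener_or A v.
  by have := diagram_le u d; rewrite uv w2 // ltnS leqNgt lt_uv.
have [lcv pcv] := A1 _ _ cv; have wcv := w1 _ _ cv.
case: (ltngtP u c) => [uc|cu|/val_inj ->].
- have [||[u' uu' u'c] puc] := IH u c _ _ uc; first exact: leq_trans lcv _.
    by rewrite uv wcv.
  split; last exact: ltn_trans puc pcv.
  by exists u' => //; apply: leq_trans u'c (ltnW _).
- have [||[u' uu' u'c] _] := IH c u _ _ cu; first exact: leq_trans lt_uv _.
    by rewrite uv wcv.
  have e := arcs_right (conj A1 A2) cv uu'.
  by move: u'c; rewrite -e leqNgt lt_uv.
- by split=> //; exists v.
Qed.

(** Within a block, labels and positions are ordered alike, so an arc leads to the next larger label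
    of the block. *)
Lemma diagram_next p A w u v l : diagram p A w -> A u v ->
  w l = w (p u) -> (p u < l)%N -> (p v <= l)%N.
Proof.
move=> d uv; rewrite -[l](permKV p); move: (p^-1%g l) => t wt pt.
case: (ltngtP u t) => [ut|tu|e]; last 2 first.
- by have [_] := diagram_chain d wt tu; rewrite ltnNge ltnW.
- by move: pt; rewrite (val_inj e) ltnn.
have [[u' uu' u't] _] := diagram_chain d (esym wt) ut.
have [[A1 A2] w1 w2] := d; rewrite (arcs_right (conj A1 A2) uv uu').
move: u't; rewrite leq_eqVlt => /predU1P[/val_inj -> //|u't]; apply: ltnW.
by have [] := diagram_chain d _ u't; rewrite // -(w1 _ _ uu').
Qed.

(** The root of a block has its smallest label, and its position is read off the letter. *)
Lemma diagram_opener p A w b l : diagram p A w -> w l = b.+1 ->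
  [/\ opener A b, w (p b) = b.+1 & (p b <= l)%N].
Proof.
move=> d; rewrite -[l](permKV p); move: (p^-1%g l) => t wt.
have [r [rt or wr wt']] := diagram_root t d.
have e : r = b by apply: val_inj; move: wt; rewrite wt' => -[].
split; rewrite -?e //; move: rt; rewrite leq_eqVlt => /predU1P[/val_inj -> //|rt].
by have [] := diagram_chain d _ rt; rewrite ?wr // => _ /ltnW.
Qed.

(* If two diagrams of the same word agree before position a, the arc ending at
   a cannot start earlier in the first than in the second: the earlier start
   would have to be served later, hence would be nested around a. *)
Lemma diagram_source_le p A p' A' w a c c' : diagram p A w -> diagram p' A' w ->
  (forall b, (b < a)%N -> p b = p' b /\ forall d, A d b = A' d b) ->
  A c a -> A' c' a -> (c' <= c)%N.
Proof.
move=> d d' IH ca c'a; rewrite leqNgt; apply/negP => cc.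
have [arc w1 _] := d; have [arc' w1' _] := d'.
have [lca pca] := arc.1 _ _ ca; have [lc'a _] := arc'.1 _ _ c'a.
have [pc _] := IH _ lca.
pose t := p'^-1%g (p a); have pt : p' t = p a by rewrite permKV.
have wt : w (p' c) = w (p' t) by rewrite pt -pc (w1 _ _ ca).
have ct : (c < t)%N.
  case: (ltngtP c t) => // [tc|/val_inj e].
    have [_] := diagram_chain d' (esym wt) tc.
    by rewrite pt -pc ltnNge (ltnW pca).
  by move: pca; rewrite pc -pt -e ltnn.
have [[u' cu' _] _] := diagram_chain d' wt ct.
case: (ltngtP u' a) => [u'a|au'|/val_inj e].
- have [_ /(_ c)] := IH _ u'a; rewrite cu' => cu.
  by move: u'a; rewrite (arcs_right arc cu ca) ltnn.
- by have [] := arc'.2 _ _ _ _ cu' c'a (ltnW cc) (ltnW au') => e; move: cc; rewrite e ltnn.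
- rewrite e in cu'; have [] := arc'.2 _ _ _ _ cu' c'a (ltnW cc) (leqnn _).
  by move=> e'; move: cc; rewrite e' ltnn.
Qed.

(** Position by position: an opener carries the smallest label with its letter, and any other
    position the label following that of its source, which [diagram_source_le] makes the same in
    both diagrams. *)
Lemma diagram_inj p A p' A' w : diagram p A w -> diagram p' A' w ->
  p = p' /\ A =2 A'.
Proof.
move=> d d'; suff h a : p a = p' a /\ forall c, A c a = A' c a.
  by split=> [|c a]; [apply/permP => a; have [] := h a|have [] := h a].
have [m am] := ubnP (a : nat); elim: m a am => // m IHm a am.
have IH b : (b < a)%N -> p b = p' b /\ forall c, A c b = A' c b.
  by move=> ba; apply: IHm; exact: leq_trans ba _.
have IH' b : (b < a)%N -> p' b = p b /\ forall c, A' c b = A c b.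
  by move=> /IH [-> h]; split.
have [oa|[c ca]] := opener_or A a.
  have [_ _ /(_ _ oa) w2] := d; have [oa' w2' le1] := diagram_opener d' w2.
  have [_ _ le2] := diagram_opener d w2'.
  split; first by apply/val_inj/anti_leq; rewrite le1 le2.
  by move=> c; rewrite (negPf (oa c)) (negPf (oa' c)).
have [oa'|[c' ca']] := opener_or A' a.
  have [_ _ /(_ _ oa') w2] := d'; have [oa _ _] := diagram_opener d w2.
  by move: ca; rewrite (negPf (oa c)).
have e : c = c'.
  apply/val_inj/anti_leq; rewrite (diagram_source_le d' d IH' ca' ca).
  by rewrite (diagram_source_le d d' IH ca ca').
rewrite -{c'}e in ca'.
have [arc w1 _] := d; have [arc' w1' _] := d'.
have [lca pca] := arc.1 _ _ ca; have [_ pca'] := arc'.1 _ _ ca'.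
have [pc _] := IH _ lca; split.
  apply/val_inj/anti_leq; apply/andP; split.
    by apply: (diagram_next d ca); rewrite pc // -(w1' _ _ ca').
  by apply: (diagram_next d' ca'); rewrite -pc // -(w1 _ _ ca).
move=> e; have [->|ec] := eqVneq e c; first by rewrite ca ca'.
(* Two arcs with the same right end would be nested. *)
have left q B : arcs q B -> B c a -> B e a = false.
  move=> [_ B2] Bc; apply/negP => Be; case/negP: ec.
  case: (leqP e c) => le; first by have [->] := B2 _ _ _ _ Be Bc le (leqnn _).
  by have [->] := B2 _ _ _ _ Bc Be (ltnW le) (leqnn _).
by rewrite (left _ _ arc ca) (left _ _ arc' ca').
Qed.

Lemma parkingP w : parking w <->
  (forall i, 1 <= w i <= n)%N /\
  forall k, (k <= n)%N -> (k <= #|[set l | (w l <= k)%N]%SET|)%N.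
Proof.
have cnt k : count (fun x => x <= k)%N (sort leq (codom w)) = #|[set l | (w l <= k)%N]%SET|.
  rewrite (seq.permP (permEl (perm_sort _ _))) /codom /image_mem count_map.
  rewrite enumT cardE /enum_mem size_filter; apply: eq_count => l /=; by rewrite inE.
have sz : size (sort leq (codom w)) = n by rewrite size_sort size_codom card_ord.
have st : sorted leq (sort leq (codom w)) by apply: sort_sorted; exact: leq_total.
split=> -[w1 h]; split=> //.
  move=> k kn; rewrite -cnt; case: k kn => // k kn; rewrite leqNgt; apply/negP => ck.
  have := h (Ordinal kn); apply/negP; rewrite -ltnNge.
  apply: (@Order.TotalTheory.DualTotalTheory.nth_count_gt _ nat) => //=.
  by rewrite sz kn andbT -ltnS.
by move=> i; apply: (@Order.PreorderTheory.nth_count_le _ nat) => //; rewrite cnt; exact: h.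
Qed.

(** The letter at position [b] is at most [b + 1], so the first [k] positions supply [k] letters
    that are at most [k]. *)
Lemma diagram_parking p A w : diagram p A w -> parking w.
Proof.
move=> d; apply/parkingP; split=> [i|k kn].
  rewrite -[i](permKV p); have [r [_ _ _ ->]] := diagram_root (p^-1%g i) d.
  exact: ltn_ord.
have : (p @: [set b : 'I_n | (b < k)%N] \subset [set l | (w l <= k)%N])%SET.
  apply/fintype.subsetP => _ /imsetP[b + ->]; rewrite !inE => bk.
  exact: leq_trans (diagram_le b d) bk.
move=> /subset_leq_card; apply: leq_trans; rewrite card_imset; last exact: perm_inj.
by rewrite -sum1dep_card big_ord_narrow ?sum1_card ?card_ord.
Qed.

End Diagrams.

(** * Construction of a diagram by a queue *)

Section Fifo.
Context {n : nat} (w : {ffun 'I_n -> nat}).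
Implicit Types (l v : 'I_n) (a b c m : nat) (s : nat -> 'I_n) (g : nat -> nat).

Definition starts b := [exists l, w l == b.+1].

(** Labels of a block are served in increasing order, so this says that [v] is not the last of its
    block. *)
Definition has_next v := [exists l, (w l == w v) && (v < l)%N].

(* The words built by serving the open blocks first in, first out: s b is the
   label in position b and, unless a block starts there, g b is the position of
   the previous element of its block. *)
Definition fifo m s g :=
  [/\ forall a b, (a < m)%N -> (b < m)%N -> s a = s b -> a = b,
      forall b, (b < m)%N -> starts b ->
        w (s b) = b.+1 /\ forall l, w l = b.+1 -> (s b <= l)%N,
      forall b, (b < m)%N -> ~~ starts b ->
        [/\ (g b < b)%N, w (s b) = w (s (g b)), (s (g b) < s b)%N &
            forall l, w l = w (s (g b)) -> (s (g b) < l)%N -> (s b <= l)%N],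
      forall b b', (b < b')%N -> (b' < m)%N -> ~~ starts b -> ~~ starts b' ->
        (g b < g b')%N &
      forall b c, (b < m)%N -> ~~ starts b -> (c < g b)%N -> has_next (s c) ->
        exists b', [/\ (b' < b)%N, ~~ starts b' & g b' = c]].

Definition extend T (f : nat -> T) m (x : T) b := if b == m then x else f b.

Lemma extend_eq T (f : nat -> T) m x : extend f m x m = x.
Proof. by rewrite /extend eqxx. Qed.

Lemma extend_lt T (f : nat -> T) m x b : (b < m)%N -> extend f m x b = f b.
Proof. by move=> bm; rewrite /extend ltn_eqF. Qed.

(** Only the conditions at the new position [m] have to be checked; when a block starts there, the
    source [c] is arbitrary. *)
Lemma fifo_extend m s g v c : fifo m s g ->
  (forall a, (a < m)%N -> s a <> v) ->
  (starts m -> w v = m.+1 /\ forall l, w l = m.+1 -> (v <= l)%N) ->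
  (~~ starts m ->
    [/\ (c < m)%N, w v = w (s c), (s c < v)%N,
        forall l, w l = w (s c) -> (s c < l)%N -> (v <= l)%N &
        forall b, (b < m)%N -> ~~ starts b -> (g b < c)%N] /\
    forall c0, (c0 < c)%N -> has_next (s c0) ->
        exists b', [/\ (b' < m)%N, ~~ starts b' & g b' = c0]) ->
  fifo m.+1 (extend s m v) (extend g m c).
Proof.
move=> [f1 f2 f3 f4 f5] h1 h2 h3; split.
- move=> a b; rewrite ltnS leq_eqVlt => am; rewrite ltnS leq_eqVlt => bm.
  case/predU1P: am => [->|am]; case/predU1P: bm => [->|bm] //;
    rewrite ?extend_eq ?extend_lt //.
  + by move/esym/h1 => /(_ bm).
  + by move/h1 => /(_ am).
  + exact: f1.
- move=> b; rewrite ltnS leq_eqVlt => /predU1P[->|bm]; rewrite ?extend_eq ?extend_lt //.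
  exact: f2.
- move=> b; rewrite ltnS leq_eqVlt => /predU1P[->|bm] nb.
    by rewrite !extend_eq; have [[cm e1 e2 e3 _] _] := h3 nb; rewrite extend_lt.
  have [gb e1 e2 e3] := f3 _ bm nb; rewrite ![extend _ _ _ b]extend_lt //.
  by rewrite extend_lt // (ltn_trans gb).
- move=> b b' bb; rewrite ltnS leq_eqVlt => /predU1P[e|bm] nb nb'.
    rewrite e in bb nb' *; rewrite extend_eq extend_lt //.
    by have [[_ _ _ _ h] _] := h3 nb'; exact: h.
  by rewrite !extend_lt //; [exact: f4|exact: ltn_trans bb bm].
- move=> b c0; rewrite ltnS leq_eqVlt => /predU1P[->|bm] nb.
    rewrite extend_eq => cc; have [[cm _ _ _ _] h] := h3 nb.
    rewrite extend_lt ?(ltn_trans cc) // => /h -/(_ cc) [b' [b'm nb' <-]].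
    by exists b'; rewrite extend_lt.
  rewrite [extend _ _ _ b]extend_lt // => cg.
  have [gb _ _ _] := f3 _ bm nb; have cm := ltn_trans cg (ltn_trans gb bm).
  rewrite extend_lt // => hn; have [b' [bb nb' e]] := f5 _ _ bm nb cg hn.
  by exists b'; rewrite extend_lt // (ltn_trans bb).
Qed.

(** It follows that no label with letter [m + 1] is served before position [m]. *)
Lemma fifo_word_le m s g b : fifo m s g -> (b < m)%N -> (w (s b) <= b.+1)%N.
Proof.
move=> [_ f2 f3 _ _]; have [k bk] := ubnP b; elim: k b bk => // k IH b bk bm.
have [sb|nb] := boolP (starts b); first by have [-> _] := f2 _ bm sb.
have [gb -> _ _] := f3 _ bm nb; apply: (@leq_trans (g b).+1).
  by apply: IH; [exact: leq_trans gb _|exact: ltn_trans gb bm].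
by rewrite ltnS ltnW.
Qed.

Hypothesis w_range : forall i, (1 <= w i <= n)%N.
Hypothesis w_count :
  forall k, (k <= n)%N -> (k <= #|[set l | (w l <= k)%N]%SET|)%N.

(** The parking condition gives [m + 1] labels with letter at most [m + 1], so one of them is not
    yet served. Its block has started, and the largest served label of the block below it awaits a
    successor. *)
Lemma fifo_pending m s g : (m < n)%N -> fifo m s g -> ~~ starts m ->
  exists2 c, (c < m)%N /\ has_next (s c) &
    forall b, (b < m)%N -> ~~ starts b -> g b <> c.
Proof.
move=> mn f nm; have [f1 f2 f3 f4 f5] := f.
have [l] : exists l, (w l <= m.+1)%N && (l \notin [seq s a | a <- iota 0 m]).
  apply/existsP; apply: contraLR (w_count mn) => /existsPn h; rewrite -ltnNge ltnS.
  rewrite cardE -[X in (_ <= X)%N](size_iota 0) -(size_map s); apply: uniq_leq_size.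
    exact: enum_uniq.
  by move=> l; rewrite mem_enum inE => wl; have := h l; rewrite wl /= negbK.
move=> /andP[wl ls].
have {}ls a : (a < m)%N -> s a <> l.
  by move=> am e; move: ls; rewrite -e map_f // mem_iota.
have [r wr] : exists r, w l = r.+1.
  by have /andP[+ _] := w_range l; case: (w l) => // r _; exists r.
have rm : (r < m)%N.
  move: wl; rewrite wr ltnS leq_eqVlt => /predU1P[e|//].
  by case/negP: nm; apply/existsP; exists l; rewrite wr e.
have sr : starts r by apply/existsP; exists l; rewrite wr.
have [wsr srl] := f2 _ rm sr.
pose P (c : 'I_m) := (w (s c) == w l) && (s c < l)%N.
have P0 : P (Ordinal rm).
  rewrite /P /= wsr wr eqxx ltn_neqAle srl // andbT.
  by apply/eqP => /val_inj; exact: ls.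
case: (arg_maxnP (fun c : 'I_m => s c : nat) P0) => c /andP[/eqP wc cl] cmax.
exists c.
  by split=> //; apply/existsP; exists l; rewrite wc eqxx.
move=> b bm nb e; have [gb w1 lt1 nx] := f3 _ bm nb.
rewrite e in w1 lt1 nx; have bl := nx l (esym wc) cl.
have [/val_inj|ne] := eqVneq (s b : nat) l; first exact: ls.
have := cmax (Ordinal bm); rewrite /P /= w1 wc eqxx ltn_neqAle bl ne => /(_ isT).
by rewrite leqNgt lt1.
Qed.

Lemma fifo_step m s g : (m < n)%N -> fifo m s g -> exists s' g', fifo m.+1 s' g'.
Proof.
move=> mn f; have [f1 f2 f3 f4 f5] := f.
have [sm|nm] := boolP (starts m).
  have /existsP[l0 l0P] := sm.
  case: (@arg_minnP _ l0 (fun l => w l == m.+1) (fun l : 'I_n => l : nat) l0P) => v /eqP wv vmin.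
  exists (extend s m v), (extend g m 0); apply: fifo_extend => //.
  - move=> a am e; have := fifo_word_le f am.
    by rewrite e wv ltnS leqNgt am.
  - by split=> // l /eqP /vmin.
  - by rewrite sm.
(* [Q c] says that position [c] still waits in the queue; the smallest such [c] is its front. *)
pose Q c := [&& (c < m)%N, has_next (s c) &
  ~~ [exists b : 'I_m, ~~ starts b && (g b == c)]].
have QP c : (c < m)%N -> has_next (s c) -> ~~ Q c ->
    exists b', [/\ (b' < m)%N, ~~ starts b' & g b' = c].
  move=> cm hc; rewrite /Q cm hc negbK => /existsP[b /andP[nb /eqP gb]].
  by exists b.
have nQ c b : Q c -> (b < m)%N -> ~~ starts b -> g b <> c.
  move=> /and3P[_ _ /existsPn h] bm nb e.
  by have := h (Ordinal bm); rewrite /= nb e eqxx.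
have exQ : exists c, Q c.
  have [c [cm hc] h] := fifo_pending mn f nm; exists c; rewrite /Q cm hc /=.
  by apply/existsPn => b; apply/negP => /andP[nb /eqP]; exact: h.
case: (ex_minnP exQ) => c Qc cmin; have /and3P[cm /existsP[l0 l0P] _] := Qc.
pose next l := (w l == w (s c)) && (s c < l)%N.
case: (@arg_minnP _ l0 next (fun l : 'I_n => l : nat) l0P) => v /andP[/eqP wv cv] vmin.
have {}vmin l : w l = w (s c) -> (s c < l)%N -> (v <= l)%N.
  by move=> wl cl; apply: vmin; rewrite /next wl eqxx.
exists (extend s m v), (extend g m c); apply: fifo_extend => //; last first.
- move=> _; split; last first.
    move=> c0 cc hn; apply: QP => //; first exact: ltn_trans cc cm.
    by apply/negP => /cmin; rewrite leqNgt cc.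
  split=> // b bm nb; case: (ltngtP (g b) c) => // [cg|e]; last by case: (nQ c b).
  have [b' [bb nb' e]] := f5 _ _ bm nb cg (introT existsP (ex_intro _ l0 l0P)).
  by case: (nQ c b') => //; exact: ltn_trans bb bm.
- by move=> sm; rewrite sm in nm.
(* [v] is new: being larger than the label at [c] it starts no block, and any source it had would be
   [c], which is still waiting. *)
move=> a am e; have [sa|na] := boolP (starts a).
  have [wa /(_ (s c))] := f2 _ am sa; rewrite -wv -e wa => /(_ erefl).
  by rewrite e leqNgt cv.
have [ga w1 lt1 nx] := f3 _ am na; rewrite e in w1 lt1 nx.
have gm := ltn_trans ga am.
case: (ltngtP (s c) (s (g a))) => [lt|lt|/val_inj/esym/(f1 _ _ gm cm)].
- by have := vmin (s (g a)); rewrite -w1 wv lt leqNgt lt1 => /(_ erefl erefl).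
- by have := nx (s c); rewrite -w1 wv lt leqNgt cv => /(_ erefl erefl).
- exact: nQ.
Qed.

Lemma diagram_exists (i0 : 'I_n) : exists p A, diagram p A w.
Proof.
have [s [g [f1 f2 f3 f4 f5]]] : exists s g, fifo n s g.
  suff h m : (m <= n)%N -> exists s g, fifo m s g by exact: h.
  (* [i0] serves as the default label of the empty construction. *)
  elim: m => [_|m IH mn]; first by exists (fun=> i0), id; split.
  by have [s [g f]] := IH (ltnW mn); exact: fifo_step mn f.
have s_inj : injective (fun a : 'I_n => s a).
  by move=> a b /f1 e; apply/val_inj/e.
exists (perm s_inj), (fun a b => ~~ starts b && (g b == a)).
split; first split.
- move=> a b /andP[nb /eqP ga]; rewrite !permE -ga.
  by have [] := f3 _ (ltn_ord b) nb.
- move=> a b a' b' /andP[nb /eqP ga] /andP[nb' /eqP ga'] aa; rewrite leq_eqVlt.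
  move=> /predU1P[/val_inj e|bb].
    by split=> //; apply: val_inj; rewrite /= -ga -ga' e.
  by have := f4 _ _ bb (ltn_ord b) nb' nb; rewrite ga ga' ltnNge aa.
- move=> a b /andP[nb /eqP ga]; rewrite !permE -ga.
  by have [_ ->] := f3 _ (ltn_ord b) nb.
- move=> b ob; rewrite permE; have [sb|nb] := boolP (starts b).
    by have [] := f2 _ (ltn_ord b) sb.
  have [gb _ _ _] := f3 _ (ltn_ord b) nb.
  by have := ob (Ordinal (ltn_trans gb (ltn_ord b))); rewrite nb eqxx.
Qed.

End Fifo.

(** * Smallest elements of the blocks *)

Section BlockMinimum.
Context {n : nat} (A : rel 'I_n).
Hypothesis A_lt : forall a b, A a b -> (a < b)%N.
Hypothesis A_left : forall a a' b, A a b -> A a' b -> a = a'.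

Let link a b := A a b || A b a.

Let pre b := odflt b [pick a | A a b].

Let preP a b : A a b -> pre b = a.
Proof. by move=> ab; rewrite /pre; case: pickP => [c /A_left/(_ ab)|/(_ a)] //=; rewrite ab. Qed.

Let pre_opener b : opener A b -> pre b = b.
Proof. by move=> ob; rewrite /pre; case: pickP => // a; rewrite (negPf (ob a)). Qed.

(** Each step back lowers the position until an opener is reached, so [m] steps suffice from a
    position at most [m]. *)
Let pre_iter m (b : 'I_n) : (b <= m)%N -> pre (iter m pre b) = iter m pre b.
Proof.
elim: m b => [|m IH] b bm.
  by apply: pre_opener => a; apply/negP => /A_lt; move: bm; rewrite leqn0 => /eqP ->.
rewrite iterSr; have [ob|[a ab]] := opener_or A b.
  by rewrite (pre_opener ob) iter_fix pre_opener.
rewrite (preP ab); apply: IH; have := A_lt ab; lia.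
Qed.

Let root b := iter n pre b.

Let root_arc a b : A a b -> root a = root b.
Proof.
move=> ab; have h m : (a <= m)%N -> iter m.+1 pre a = iter m.+1 pre b.
  by move=> am; rewrite [RHS]iterSr (preP ab) iterS pre_iter.
have n0 : (0 < n)%N by case: a {ab h} => a; exact: leq_ltn_trans.
by have := h n.-1; rewrite (prednK n0); apply; rewrite -ltnS prednK.
Qed.

Let root_connect a b : connect link a b -> root a = root b.
Proof.
move=> ab; have sym : connect_sym link.
  by apply: sym_connect_sym => c d; rewrite /link orbC.
have : fingraph.closed link [pred c | root c == root a].
  by apply: (intro_closed sym) => c d /orP[] /root_arc cd; rewrite !inE cd.
by move=> /closed_connect /(_ _ _ ab); rewrite !inE eqxx => /esym/eqP.
Qed.

Let part := equivalence_partition (connect link) [set: 'I_n]%SET.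

Let block_min (a : 'I_n) : 'I_n :=
  [arg min_(b < a in finset.pblock part a) (b : nat)]%N.

Let mem_block a b : (b \in finset.pblock part a) = connect link a b.
Proof.
apply: pblock_equivalence_partition; rewrite ?inE //.
apply: in3W; apply/equivalence_relP; split=> [c|c d cd].
  exact: connect0.
move=> e; apply/idP/idP; last exact: connect_trans.
apply: connect_trans; rewrite (@sym_connect_sym _ link) // => u v.
by rewrite /link orbC.
Qed.

Let block_minP a : connect link a (block_min a) /\
  forall b, connect link a b -> (block_min a <= b)%N.
Proof.
rewrite /block_min; case: arg_minnP; first by rewrite mem_block connect0.
by move=> b; rewrite mem_block => ab h; split=> // c ac; apply: h; rewrite mem_block.
Qed.

Lemma block_min_arc a b : A a b -> block_min a = block_min b.
Proof.
move=> ab; have [ca ma] := block_minP a; have [cb mb] := block_minP b.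
have lab : connect link a b by apply: connect1; rewrite /link ab.
have lba : connect link b a by apply: connect1; rewrite /link ab orbT.
apply/val_inj/anti_leq; rewrite ma ?mb //.
  exact: connect_trans lba ca.
exact: connect_trans lab cb.
Qed.

(** The minimum of a block receives no arc, and [root] is constant on blocks and fixes openers. *)
Lemma block_min_opener b : opener A b -> block_min b = b.
Proof.
move=> ob; have [cb mb] := block_minP b.
have om : opener A (block_min b).
  move=> a; apply/negP => am; have := A_lt am; rewrite ltnNge mb //.
  by apply: connect_trans cb _; apply: connect1; rewrite /link am orbT.
have fix_root c : opener A c -> root c = c.
  by move=> /pre_opener h; rewrite /root iter_fix.
by rewrite -{2}(fix_root _ ob) (root_connect cb) fix_root.
Qed.

End BlockMinimum.

(** * Regions of the Shi arrangement *)

Section Shi.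
Context {R : realType} {n : nat}.
Implicit Types (x y : 'rV[R]_n) (p : {perm 'I_n}) (a b c d i j : 'I_n).

Definition shi_triple i j k := (i < j)%N && (k <= 1)%N.

Lemma Shi_arrangement : Shi R n = arrangement shi_triple.
Proof.
apply/seteqP; split=> H.
  by move=> [i [j [ij [->|->]]]]; [exists i, j, 0%N|exists i, j, 1%N]; rewrite /shi_triple ij.
move=> [i [j [k [/andP[ij k1] ->]]]]; exists i, j; split=> //.
by case: k k1 => [|[|]] // _; [left|right].
Qed.

Lemma shi_triple_bound i j k : shi_triple i j k -> (i < j)%N /\ (k <= n)%N.
Proof.
move=> /andP[ij k1]; split=> //; apply: leq_trans k1 _.
by apply: leq_ltn_trans (ltn_ord i).
Qed.

Lemma shi_triple0 i j : (i < j)%N -> shi_triple i j 0.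
Proof. by rewrite /shi_triple => ->. Qed.

Lemma shi_triple1 i j : (i < j)%N -> shi_triple i j 1.
Proof. by rewrite /shi_triple => ->. Qed.

(** The pairs whose hyperplane at offset 1 lies above the region; pairs of increasing labels in
    decreasing position order satisfy this bound in any case and are left out. *)
Definition close_pair x p : rel 'I_n :=
  fun c d => [&& (c < d)%N, (p c < p d)%N & dif x (p c) (p d) < 1].

(** The closure of [A] under shrinking intervals, a monotone input for [realize]. *)
Definition spans (A : rel 'I_n) (c d : nat) :=
  [exists a, exists b, [&& A a b, a <= c & d <= b]%N].

Lemma spansP (A : rel 'I_n) (c d : nat) : reflect (exists a b, [/\ A a b, (a <= c)%N & (d <= b)%N]) (spans A c d).
Proof.
apply: (iffP existsP) => [[a /existsP[b /and3P[]]]|[a [b [h1 h2 h3]]]].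
  by exists a, b.
by exists a; apply/existsP; exists b; rewrite h1 h2.
Qed.

Lemma sorting_dif_le x p a b c d : sorting x p -> (a <= c)%N -> (d <= b)%N ->
  dif x (p c) (p d) <= dif x (p a) (p b).
Proof.
move=> sx; have le c' d' : (c' <= d')%N -> x ord0 (p d') <= x ord0 (p c').
  by rewrite leq_eqVlt => /predU1P[/val_inj ->|/sx/ltW].
by move=> /le h1 /le h2; rewrite /dif; lra.
Qed.

Definition sort_point p (y : nat -> R) : 'rV[R]_n := \row_l y (p^-1%g l).

Lemma sort_pointE p (y : nat -> R) a : sort_point p y ord0 (p a) = y a.
Proof. by rewrite mxE permK. Qed.

Lemma dif_sort_point p (y : nat -> R) a b : dif (sort_point p y) (p a) (p b) = y a - y b.
Proof. by rewrite /dif !sort_pointE. Qed.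

Lemma realize_arcs p (A : rel 'I_n) :
  exists x, [/\ sorting x p, generic shi_triple x &
    forall c d, close_pair x p c d = [&& (c < d)%N, (p c < p d)%N & spans A c d]].
Proof.
have [|y hy] := @realize R (spans A) n.
  move=> a b a' b' /spansP[a0 [b0 [h1 h2 h3]]] aa bb; apply/spansP.
  by exists a0, b0; split=> //; [exact: leq_trans h2 aa|exact: leq_trans bb h3].
have hy' a b : (a < b)%N -> [/\ y b < y a, y a - y b != 1 & (y a - y b < 1) = spans A a b].
  by move=> ab; apply: hy; rewrite ab /=.
have sx : sorting (sort_point p y) p.
  by move=> a b /hy' []; rewrite !sort_pointE.
exists (sort_point p y); split=> //.
  move=> i j k /andP[ij k1]; rewrite -[i](permKV p) -[j](permKV p) dif_sort_point.
  set a := p^-1%g i; set b := p^-1%g j; case: (ltngtP a b) => [ab|ba|/val_inj/perm_inj e].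
  - have [h1 h2 _] := hy' _ _ ab; case: k k1 => [|[|]] // _.
    by rewrite gt_eqF // subr_gt0.
  - have [h1 _ _] := hy' _ _ ba; rewrite lt_eqF //.
    by rewrite (@lt_le_trans _ _ 0) ?subr_lt0.
  - by move: ij; rewrite e ltnn.
move=> c d; rewrite /close_pair dif_sort_point; case: ltnP => //= cd; case: ltnP => //= _.
by have [_ _ ->] := hy' _ _ cd.
Qed.

Section Region.
Variables (x : 'rV[R]_n) (p : {perm 'I_n}).
Hypotheses (gx : generic shi_triple x) (sx : sorting x p).

Let region_permE : region_perm (cell shi_triple x) = p.
Proof. exact: region_perm_cell shi_triple0 _ _ gx sx. Qed.

(** Where the hyperplane of [(a, b)] is touched the difference is 1, so wider pairs are not close.
    Conversely, dropping a maximal close pair leaves a realizable family, and the new point differs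
    from [x] across that hyperplane only. *)
Lemma shi_linkP a b : reflect
  (close_pair x p a b /\ forall a' b', close_pair x p a' b' -> (a' <= a)%N -> (b <= b')%N ->
    a' = a /\ b' = b)
  (shi_link (cell shi_triple x) a b).
Proof.
apply: (iffP idP); rewrite /shi_link region_permE Shi_arrangement.
  move=> /asboolP h; have [/andP[pab _] _] := ceiling_mem shi_triple_bound (k := 1) h.
  have [x1 [q [q1 qn]]] := ceiling_touches shi_triple_bound gx (shi_triple1 pab) (k := 1) isT h.
  have sq : sorting q p.
    by apply: sorting_same sx => i j /shi_triple0 ij; apply: (qn _ _ _ ij) => -[].
  have ab : (a < b)%N.
    by rewrite -(sortingE _ _ sq) -subr_gt0 (q1 : q _ _ - _ = _) ltr01.
  split; first by rewrite /close_pair ab pab x1.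
  move=> a' b' /and3P[ab' pab' x1'] aa bb.
  have [[/perm_inj -> /perm_inj ->]//|ne] := pselect ((p a', p b') = (p a, p b)).
  have [|_] := qn _ _ _ (shi_triple1 pab'); first by move=> [e1 e2]; case: ne; rewrite e1 e2.
  by rewrite x1' ltNge -[1%:R]q1 sorting_dif_le.
move=> [/and3P[ab pab x1] mx]; apply/asboolP.
(* All close pairs except [(a, b)], which by maximality is spanned by none of the others. *)
pose A c d := close_pair x p c d && ((c, d) != (a, b)).
have [y [sy gy cy]] := realize_arcs p A.
have ny : ~~ spans A a b.
  apply/spansP => -[a' [b' [/andP[c' /eqP ne] aa bb]]]; case: ne.
  by have [-> ->] := mx _ _ c' aa bb.
apply: (@ceiling_flip _ _ _ shi_triple_bound x _ _ 1 y) => //.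
- exact: shi_triple1.
- rewrite lt_neqAle eq_sym gy ?shi_triple1 //= leNgt.
  by have := cy a b; rewrite /close_pair ab pab (negPf ny) => /= ->.
move=> i j k tijk ne; split; first exact: gy.
case/andP: (tijk) => ij; case: k tijk ne => [|[|//]] tijk ne _.
  by rewrite /dif !subr_lt0 (sortingVE _ _ sx) (sortingVE _ _ sy).
rewrite -[i](permKV p) -[j](permKV p); set c := p^-1%g i; set d := p^-1%g j.
have pcd : (p c < p d)%N by rewrite !permKV.
case: (ltngtP c d) => [cd|dc|/val_inj e]; last by move: pcd; rewrite e ltnn.
  have := cy c d; rewrite /close_pair cd pcd /= => ->; apply/spansP/idP.
    move=> [a' [b' [/andP[/and3P[_ _ h] _] h1 h2]]]; apply: le_lt_trans h.
    exact: sorting_dif_le.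
  move=> h; exists c, d; split=> //; rewrite /A /close_pair cd pcd h /=; apply/eqP => -[e1 e2].
  by case: ne; rewrite -e1 -e2 !permKV.
have neg z : sorting z p -> dif z (p c) (p d) < 1%:R.
  by move=> /(_ _ _ dc) h; rewrite /dif (@lt_trans _ _ 0) ?subr_lt0 ?ltr01.
by rewrite !neg.
Qed.

Lemma close_link c d : close_pair x p c d =
  [&& (c < d)%N, (p c < p d)%N & spans (shi_link (cell shi_triple x)) c d].
Proof.
apply/idP/idP => [cd|/and3P[cd pcd /spansP[a [b [/shi_linkP[ab _] ac db]]]]]; last first.
  rewrite /close_pair cd pcd /=; case/and3P: ab => _ _; apply: le_lt_trans.
  exact: sorting_dif_le.
have /and3P[lcd pcd _] := cd; rewrite lcd pcd /=.
pose P (u : 'I_n * 'I_n) := [&& close_pair x p u.1 u.2, u.1 <= c & d <= u.2]%N.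
have P0 : P (c, d) by rewrite /P /= cd !leqnn.
(* A longest close pair around [(c, d)] is maximal. *)
case: (arg_maxnP (fun u : 'I_n * 'I_n => u.2 - u.1)%N P0) => -[a b] /and3P[/= ab ac db] mx.
apply/spansP; exists a, b; split=> //; apply/shi_linkP; split=> // a' b' ab' aa bb.
have := mx (a', b'); rewrite /P /= ab' (leq_trans aa) ?(leq_trans db) // => /(_ isT).
have := ltn_ord a'; case/and3P: ab => ab _ _; case/and3P: ab' => ab' _ _ ? h.
by split; apply: val_inj; move: h aa bb ab ab' => /=; lia.
Qed.

Lemma shi_link_arcs : arcs p (shi_link (cell shi_triple x)).
Proof.
split=> [a b /shi_linkP[/and3P[]] //|a b a' b' /shi_linkP[ab _] /shi_linkP[_ mx] aa bb].
by have [] := mx _ _ ab aa bb.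
Qed.

Lemma shi_diagram :
  diagram p (shi_link (cell shi_triple x)) (shi_word (cell shi_triple x)).
Proof.
have arc := shi_link_arcs; have A_lt a b (h : shi_link (cell shi_triple x) a b) := proj1 (arc.1 a b h).
have A_left a a' b : shi_link (cell shi_triple x) a b ->
    shi_link (cell shi_triple x) a' b -> a = a'.
  move=> h h'; case: (leqP a a') => aa.
    by have [] := arc.2 _ _ _ _ h h' aa (leqnn _).
  by have [] := arc.2 _ _ _ _ h' h (ltnW aa) (leqnn _).
split=> // [a b ab|b ob]; rewrite /shi_word !ffunE region_permE !permK /=.
  by rewrite (block_min_arc ab).
by rewrite (block_min_opener A_lt A_left ob).
Qed.

End Region.
End Shi.

(** * Shi words and parking functions *)

Section ShiBijection.
Context {R : realType} {n : nat}.
Implicit Types (x y : 'rV[R]_n) (p : {perm 'I_n}) (w : {ffun 'I_n -> nat}).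

Lemma cell_close x y p : generic shi_triple x -> generic shi_triple y ->
  sorting x p -> sorting y p -> close_pair x p =2 close_pair y p ->
  cell shi_triple x = cell shi_triple y.
Proof.
move=> gx gy sx sy cl; apply: cell_eq => i j k t; split; first exact: gy.
case/andP: (t) => ij; case: k t => [|[|//]] t _.
  by rewrite /dif !subr_lt0 (sortingVE _ _ sx) (sortingVE _ _ sy).
rewrite -[i](permKV p) -[j](permKV p); set c := p^-1%g i; set d := p^-1%g j.
have pcd : (p c < p d)%N by rewrite !permKV.
case: (ltngtP c d) => [cd|dc|/val_inj e]; last by move: pcd; rewrite e ltnn.
  by have := cl c d; rewrite /close_pair cd pcd /= => ->.
have neg z : sorting z p -> dif z (p c) (p d) < 1%:R.
  by move=> /(_ _ _ dc) h; rewrite /dif (@lt_trans _ _ 0) ?subr_lt0 ?ltr01.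
by rewrite !neg.
Qed.

(** As arcs are not nested, they are exactly the maximal members of the family that they span. *)
Lemma shi_link_realize p (A : rel 'I_n) x : arcs p A -> generic shi_triple x ->
  sorting x p ->
  (forall c d, close_pair x p c d = [&& (c < d)%N, (p c < p d)%N & spans A c d]) ->
  shi_link (cell shi_triple x) = A.
Proof.
move=> [A1 A2] gx sx cl; apply/funext => a; apply/funext => b.
have Acl a' b' : A a' b' -> close_pair x p a' b'.
  move=> ab; have [h1 h2] := A1 _ _ ab; rewrite cl h1 h2 /=.
  by apply/spansP; exists a', b'.
apply/(shi_linkP gx sx)/idP => [[+ mx]|ab].
  rewrite cl => /and3P[_ _ /spansP[a' [b' [ab' aa bb]]]].
  by have [<- <-] := mx _ _ (Acl _ _ ab') aa bb.
split=> [|a' b']; first exact: Acl.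
rewrite cl => /and3P[_ _ /spansP[a0 [b0 [ab0 aa bb]]]] aa' bb'.
have [e1 e2] := A2 _ _ _ _ ab0 ab (leq_trans aa aa') (leq_trans bb' bb).
by split; apply/val_inj/anti_leq; rewrite ?aa' ?bb' -?e1 -?e2 ?aa ?bb.
Qed.

Lemma shi_word_bij : (0 < n)%N ->
  set_bij (regions (Shi R n)) [set w | parking w] (@shi_word R n).
Proof.
move=> n0.
rewrite Shi_arrangement regions_arrangement; split.
- move=> _ [x gx <-]; have [p sx] := generic_sorting (@shi_triple0 n) gx.
  exact: diagram_parking (shi_diagram gx sx).
- move=> C C'; rewrite !inE => -[x gx <-] [y gy <-] e.
  have [p sx] := generic_sorting (@shi_triple0 n) gx.
  have [q sy] := generic_sorting (@shi_triple0 n) gy.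
  have dx := shi_diagram gx sx; have dy := shi_diagram gy sy; rewrite -e in dy.
  (* The word gives back the permutation and the arcs, these the close pairs, and those the cell. *)
  have [pq AA] := diagram_inj dx dy; rewrite -{q}pq in sy dy *.
  apply: (cell_close gx gy sx sy) => c d; rewrite !close_link //.
  by congr [&& _, _ & _]; apply: eq_existsb => a; apply: eq_existsb => a'; rewrite AA.
- move=> w /= pw; have [w1 w2] := (parkingP w).1 pw.
  have [p [A d]] := diagram_exists w1 w2 (Ordinal n0).
  have [x [sx gx cl]] := @realize_arcs R n p A; exists (cell shi_triple x); first by exists x.
  have [arc _ _] := d; have dx := shi_diagram gx sx.
  by rewrite (shi_link_realize arc gx sx cl) in dx; exact: diagram_word dx d.
Qed.

Lemma omega_bij : (0 < n)%N ->
  set_bij [set w | parking w] (regions (Shi R n)) (@omega R n).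
Proof. by move=> /shi_word_bij; exact: bijpinv_bij. Qed.

End ShiBijection.

(** * Cycle lemma *)

Section Cycle.
Context {n : nat}.
Implicit Types w p : {ffun 'I_n -> nat}.

Definition letters w := forall i, (1 <= w i <= n.+1)%N.

Lemma iter_shiftE w k i : letters w -> iter k Defs.shift w i = (((w i).-1 + k) %% n.+1).+1.
Proof.
move=> lw; elim: k => [|k IH].
  by have := lw i; rewrite addn0 => wi; rewrite modn_small /=; lia.
by rewrite iterS ffunE IH addnS; congr S; rewrite -addn1 modnDml addn1.
Qed.

Let below w k := [set i | (w i <= k)%N]%SET.

(** Differences of [h] compare the number of letters in an interval with its length. Counting
    letters from just after the first minimum of [h] makes every initial count large enough. *)
Lemma cycle_exists w : letters w -> exists k, parking (iter k Defs.shift w).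
Proof.
move=> lw; pose h k := (#|below w k| + (n - k))%N.
(* The factor [n.+1] makes the minimum lexicographic: least [h], then least [k]. *)
case: (@arg_minnP _ ord0 predT (fun k : 'I_n.+1 => h k * n.+1 + k)%N isT) => k0 _ kmin.
have h1 k : (k <= n)%N -> (h k0 <= h k)%N.
  move=> kn; have kn1 : (k < n.+1)%N by [].
  have := kmin (Ordinal kn1) isT; rewrite /= leqNgt; apply: contraNleq => lt_h.
  have : ((h k).+1 * n.+1 <= h k0 * n.+1)%N by rewrite leq_mul2r lt_h orbT.
  by rewrite mulSn; lia.
have h2 k : (k < k0)%N -> (h k0 < h k)%N.
  move=> kk; have kn1 : (k < n.+1)%N by exact: ltn_trans kk _.
  rewrite ltn_neqAle h1 // andbT; apply/eqP => e.
  by have := kmin (Ordinal kn1) isT; rewrite /= e leq_add2l leqNgt kk.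
(* This shift subtracts [k0] modulo [n + 1]. *)
exists (n.+1 - k0)%N; set p := iter _ Defs.shift w.
have pE i : p i = if (k0 < w i)%N then (w i - k0)%N else (w i + n.+1 - k0)%N.
  have wi := lw i; have k0n := ltn_ord k0; rewrite /p iter_shiftE //; case: ltnP => kw.
    have -> : ((w i).-1 + (n.+1 - k0) = (w i - k0.+1) + n.+1)%N by lia.
    by rewrite modnDr modn_small; lia.
  by rewrite modn_small; lia.
have cnt m : (m <= n)%N -> (m <= #|below p m|)%N.
  move=> mn; case: (leqP (k0 + m) n) => km.
    have : (#|below w (k0 + m)| <= #|below w k0| + #|below p m|)%N.
      apply: leq_trans (leq_card_setU _ _); apply: subset_leq_card.
      by apply/fintype.subsetP => i; rewrite !inE pE; case: ltnP => //; lia.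
    by have := h1 _ km; rewrite /h; lia.
  (* The interval after [k0] wraps around and ends at [j]; the strictness of [h2] supplies the unit
     lost by wrapping. *)
  pose j := (k0 + m - n.+1)%N.
  have jk : (j < k0)%N by rewrite /j; lia.
  have : (#|[set: 'I_n]%SET| <= #|below w k0 :\: below w j| + #|below p m|)%N.
    apply: leq_trans (leq_card_setU _ _); apply: subset_leq_card.
    apply/fintype.subsetP => i; rewrite !inE pE; have := lw i; rewrite /j.
    by have := ltn_ord k0; case: (ltnP k0 (w i)) => /=; lia.
  have := cardsID (below w j) (below w k0).
  have -> : (below w k0 :&: below w j = below w j)%SET.
    by apply/setP => i; rewrite !inE; lia.
  by rewrite cardsT card_ord; have := h2 _ jk; rewrite /h /j; lia.
apply/parkingP; split=> // i.
(* The letter [n + 1] does not occur, as all [n] letters are at most [n]. *)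
have : below p n = [set: 'I_n]%SET.
  apply/eqP; rewrite finset.eqEcard; apply/andP; split; last by rewrite cardsT card_ord cnt.
  by apply/fintype.subsetP => l; rewrite inE.
move=> /setP /(_ i); rewrite !inE => ->; rewrite andbT pE.
by have := lw i; have := ltn_ord k0; case: (ltnP k0 (w i)) => /=; lia.
Qed.

(** A parking function has fewer than [m] letters above [n + 1 - m], and a shift by [m] with
    [0 < m <= n] makes only these at most [m], too few for a parking function. *)
Lemma cycle_unique p k : parking p -> parking (iter k Defs.shift p) -> iter k Defs.shift p = p.
Proof.
move=> /parkingP[p1 p2] /parkingP[_ q2].
have lp : letters p by move=> i; have := p1 i; lia.
have [m0|m0] := posnP (k %% n.+1).
  apply/ffunP => i; have := lp i => pi.
  by rewrite iter_shiftE // -modnDmr m0 addn0 {m0} modn_small /=; lia.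
set m := (k %% n.+1)%N in m0; have mn : (m <= n)%N by rewrite -ltnS ltn_mod.
have := q2 _ mn; have := p2 (n.+1 - m)%N; set q := iter k Defs.shift p.
have : (#|below q m| <= #|~: below p (n.+1 - m)|)%N.
  apply: subset_leq_card; apply/fintype.subsetP => i; rewrite !inE /q iter_shiftE //.
  rewrite -modnDmr -/m; apply: contraL => pi; rewrite -ltnNge modn_small; have := lp i; lia.
have := cardsC (below p (n.+1 - m)); rewrite card_ord -/(below p _) -/(below q _); lia.
Qed.

(** The common letter at [i0] forces the two shifts to agree modulo [n + 1]. *)
Lemma orbit_head w w' k k' i0 : letters w -> letters w' -> w i0 = w' i0 ->
  iter k Defs.shift w = iter k' Defs.shift w' -> w = w'.
Proof.
move=> lw lw' e0 e; have h i : (w i).-1 + k = (w' i).-1 + k' %[mod n.+1].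
  by have /ffunP/(_ i) := e; rewrite !iter_shiftE // => -[].
have kk : k = k' %[mod n.+1].
  by have /eqP := h i0; rewrite e0 eqn_modDl => /eqP.
apply/ffunP => i; have /eqP := h i; rewrite -modnDmr kk modnDmr eqn_modDr.
have := lw i; have := lw' i => {kk h} h1 h2.
by rewrite !modn_small => [/eqP /= e1||]; rewrite /=; lia.
Qed.

Lemma iter_shift_head p i0 : letters p -> exists k, iter k Defs.shift p i0 = 1%N.
Proof.
move=> lp; exists (n.+1 - (p i0).-1)%N; rewrite iter_shiftE // subnKC ?modnn //.
by have := lp i0; lia.
Qed.

Lemma letters_iter w k : letters w -> letters (iter k Defs.shift w).
Proof. by move=> lw i; rewrite iter_shiftE // ltnS -ltnS ltn_mod. Qed.

Lemma alphaP (rho : {set square n}) : letters (rook_word rho) ->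
  parking (alpha rho) /\ orbit_shift (rook_word rho) (alpha rho).
Proof.
move=> lw; have [k pk] := cycle_exists lw.
rewrite /alpha; case: xgetP => [p _ //|h]; exfalso.
by apply: (h (iter k Defs.shift (rook_word rho))); split=> //; exists k.
Qed.

End Cycle.

(** * Rook placements *)

Section FreeRows.
Implicit Types (s : nat -> nat) (k l m j : nat) (P : pred nat).

Definition count_upto P m := count P (iota 1 m).

Lemma count_uptoS P m : count_upto P m.+1 = (count_upto P m + P m.+1)%N.
Proof. by rewrite /count_upto -[m.+1]addn1 iotaD count_cat /= add1n addn1 addn0. Qed.

Lemma count_upto_le P m m' : (m <= m')%N -> (count_upto P m <= count_upto P m')%N.
Proof.
by move=> mm; rewrite -(subnKC mm) /count_upto iotaD count_cat leq_addr.
Qed.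

Lemma count_upto_lt P m m' : (m < m')%N -> P m' -> (count_upto P m < count_upto P m')%N.
Proof.
case: m' => // m'; rewrite ltnS => mm Pm; rewrite count_uptoS Pm addn1 ltnS.
exact: count_upto_le.
Qed.

(** The count grows by at most one per row, and only at rows satisfying [P]. *)
Lemma count_upto_surj P m v : (0 < v <= count_upto P m)%N ->
  exists j, [/\ (1 <= j <= m)%N, P j & count_upto P j = v].
Proof.
elim: m => [|m IH]; first by rewrite /count_upto /=; case: v.
rewrite count_uptoS => /andP[v0 vm]; case: (leqP v (count_upto P m)) => vm'.
  have [|j [/andP[j0 jm] Pj e]] := IH; first by rewrite v0.
  by exists j; rewrite j0 (leq_trans jm).
move: vm; case Pm: (P m.+1); rewrite ?addn1 ?addn0 => vm; last by lia.
by exists m.+1; rewrite leqnn Pm count_uptoS Pm; split=> //; lia.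
Qed.

(** Indices are column numbers minus one: rook [l] stands in column [l + 1], and [l] starts at 1
    because columns start at 2. *)
Definition free s k j := all (fun l => s l != j) (iota 1 k.-1).

Lemma freeP s k j : reflect (forall l, (0 < l < k)%N -> s l <> j) (free s k j).
Proof.
apply: (iffP allP) => h l; last first.
  by rewrite mem_iota => hl; apply/eqP/h; lia.
by move=> hl; apply/eqP/h; rewrite mem_iota; lia.
Qed.

Definition distinct_below n s k :=
  (forall l, (0 < l < k)%N -> (1 <= s l <= n + l)%N) /\
  (forall l l', (0 < l)%N -> (l < l' < k)%N -> s l <> s l').

Lemma distinct_below_inj n s k l l' : distinct_below n s k ->
  (0 < l < k)%N -> (0 < l' < k)%N -> s l = s l' -> l = l'.
Proof.
move=> [_ h] hl hl' e; case: (ltngtP l l') => // ll.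
  by case: (h l l') => //; lia.
by case: (h l' l) => //; lia.
Qed.

(* The earlier rooks occupy k - 1 of the n + k rows of a column. *)
Lemma count_free n s k : (0 < k)%N -> distinct_below n s k ->
  count_upto (free s k) (n + k) = n.+1.
Proof.
move=> k0 d; have [s1 s2] := d.
suff : count (predC (free s k)) (iota 1 (n + k)) = k.-1.
  have := count_predC (free s k) (iota 1 (n + k)); rewrite size_iota /count_upto; lia.
rewrite -size_filter -[RHS](size_iota 1) -[RHS](size_map s).
apply/perm_size/uniq_perm; first by rewrite filter_uniq // iota_uniq.
  rewrite map_inj_in_uniq ?iota_uniq // => l l'; rewrite !mem_iota => hl hl'.
  by apply: (distinct_below_inj d); lia.
move=> j; rewrite mem_filter /= mem_iota; apply/andP/mapP.
  move=> [/allPn[l hl /negPn/eqP <-] _]; by exists l.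
move=> [l hl ->]; split; first by apply/allPn; exists l; rewrite ?eqxx.
by move: hl; rewrite mem_iota => hl; have := s1 l; lia.
Qed.

End FreeRows.

(** * Placements as sequences of rows *)

Section Rooks.
Context {n : nat}.
Implicit Types (s : nat -> nat) (rho : {set square n}) (i : 'I_n).

Definition rooks s : {set square n} :=
  [set q : square n | [exists i : 'I_n,
     [&& (0 < i)%N, q.1 == i.+1 :> nat & q.2 == s i :> nat]]]%SET.

Definition valid s := distinct_below n s n.

Lemma rooksP s (q : square n) : reflect
  (exists i : 'I_n, [/\ (0 < i)%N, q.1 = i.+1 :> nat & q.2 = s i :> nat]) (q \in rooks s).
Proof.
rewrite inE; apply: (iffP existsP) => -[i].
  by move=> /and3P[h1 /eqP h2 /eqP h3]; exists i.
by move=> [h1 h2 h3]; exists i; rewrite h1 h2 h3 !eqxx.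
Qed.

Lemma square_exists i j : (j <= n + i)%N ->
  exists q : square n, q.1 = i.+1 :> nat /\ q.2 = j :> nat.
Proof.
move=> ji; have h1 : (i.+1 < n.+1)%N by rewrite ltnS.
have h2 : (j < n.*2)%N by have := ltn_ord i; lia.
by exists ((Ordinal h1, Ordinal h2) : square n).
Qed.

Lemma rook_placementP rho : reflect
  ((forall q, q \in rho -> (2 <= q.1 <= n)%N /\ (1 <= q.2 <= n + q.1 - 1)%N) /\
   (forall q t, q \in rho -> t \in rho -> q <> t -> q.1 <> t.1 /\ q.2 <> t.2))
  (rook_placement rho).
Proof.
apply: (iffP andP) => -[h1 h2]; split.
- by move=> q /(fintype.subsetP h1); rewrite inE => /andP.
- move=> q t qr tr /eqP ne; move/forall_inP: h2 => /(_ q qr) /forall_inP /(_ t tr).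
  by rewrite ne => /andP[/eqP a /eqP b].
- by apply/fintype.subsetP => q /h1 [a b]; rewrite inE a b.
- apply/forall_inP => q qr; apply/forall_inP => t tr; apply/implyP => /eqP ne.
  by have [/eqP -> /eqP ->] := h2 _ _ qr tr ne.
Qed.

Lemma rooks_placement s : valid s -> rook_placement (rooks s).
Proof.
move=> d; have [s1 s2] := d; apply/rook_placementP; split.
  move=> q /rooksP[i [i0 -> ->]]; have := ltn_ord i; have := s1 i; lia.
move=> [a b] [a' b'] /rooksP[i [/= i0 e1 e2]] /rooksP[i' [/= i0' e1' e2']] ne.
suff h : i <> i'.
  split=> [/(congr1 val)|/(congr1 val)] /=.
    by rewrite e1 e1' => -[] /val_inj.
  rewrite e2 e2' => /(distinct_below_inj d) e; apply/h/val_inj/e.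
    by rewrite i0 ltn_ord.
  by rewrite i0' ltn_ord.
move=> ii; apply: ne; rewrite -ii in e1' e2'.
by congr pair; apply: val_inj; rewrite /= ?e1 ?e2.
Qed.

(** Every column of the board is already occupied. *)
Lemma rooks_maximal s : valid s -> maximal_rook_placement (rooks s).
Proof.
move=> d; apply/maxsetP; split=> [|rho' /rook_placementP[h1 h2] sub]; first exact: rooks_placement.
apply/eqP; rewrite finset.eqEsubset sub andbT; apply/fintype.subsetP => q qr.
have pre (m : nat) : (2 <= m <= n)%N -> [/\ m.-1 < n, 0 < m.-1 & m.-1.+1 = m]%N.
  by move=> h; split; lia.
have [/pre[iP i0 q1] q2] := h1 _ qr; pose i := Ordinal iP.
have [|t [t1 t2]] := @square_exists i (s i).
  by have := d.1 i; rewrite i0 ltn_ord => /(_ isT) /andP[].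
have tr : t \in rooks s by apply/rooksP; exists i.
have [<- //|ne] := eqVneq t q.
have [|ne1 _] := h2 _ _ (fintype.subsetP sub _ tr) qr; first exact/eqP.
by case: ne1; apply: val_inj; exact: etrans t1 q1.
Qed.

(** An empty column would have a row free of rooks, against maximality: its height exceeds [n],
    while there are at most [n] rooks. *)
Lemma maximal_rooks rho : maximal_rook_placement rho ->
  exists2 s, valid s & rho = rooks s.
Proof.
move=> /maxsetP[/rook_placementP[h1 h2] mx].
have col i : (0 < i)%N -> exists2 q, q \in rho & q.1 = i.+1 :> nat.
  move=> i0; apply: contrapT => none.
  have colne q : q \in rho -> q.1 <> i.+1 :> nat by move=> qr e; apply: none; exists q.
  pose rows := [set q.2 | q in rho]%SET.
  have rows_card : (#|rows| <= n)%N.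
    have inj1 : {in rho &, injective (fun q : square n => q.1)}.
      move=> q t qr tr e; apply: contrapT => ne.
      by have [] := h2 _ _ qr tr ne.
    apply: leq_trans (leq_imset_card _ _) _; rewrite -(card_in_imset inj1).
    have : ([set q.1 | q in rho] \subset [set: 'I_n.+1] :\ ord0)%SET.
      apply/fintype.subsetP => _ /imsetP[q qr ->]; rewrite !inE andbT.
      by have [h _] := h1 _ qr; apply/eqP => e; move: h; rewrite e.
    move=> /subset_leq_card; rewrite cardsDS ?subset1 ?inE //.
    by rewrite cardsT card_ord cards1 subn1.
  have [j [j1 jr]] : exists j : nat, (1 <= j <= n + i)%N /\
      forall q, q \in rho -> q.2 <> j :> nat.
    apply: contrapT => none_j; move: rows_card; rewrite leqNgt => /negP; apply.
    have sub : {subset iota 1 (n + i) <= [seq val j | j <- enum rows]}.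
      move=> j; rewrite mem_iota => hj; apply: contrapT => /negP jr; apply: none_j.
      exists j; split=> [|q qr e]; first by lia.
      by case/negP: jr; apply/mapP; exists q.2; rewrite ?mem_enum ?imset_f.
    have := uniq_leq_size (iota_uniq _ _) sub.
    by rewrite size_iota size_map -cardE; apply: leq_trans; rewrite -[X in (X < _)%N]addn0 ltn_add2l.
  have /andP[j0 jn] := j1.
  have [|q [q1 q2]] := @square_exists i j; first exact: jn.
  suff e : q |: rho = rho by apply: (colne q) => //; rewrite -e setU11.
  apply: mx; last exact: subsetU1.
  apply/rook_placementP; split=> [t|t u]; rewrite !inE.
    move=> /predU1P[->|/h1//]; rewrite q1 q2 addnS subn1 /= j0 jn.
    by rewrite !ltnS i0 ltn_ord.
  move=> /predU1P[->|tr] /predU1P[->|ur] ne //.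
  - by split=> e; [apply: (colne u ur)|apply: (jr u ur)]; rewrite -e.
  - by split=> e; [apply: (colne t tr)|apply: (jr t tr)]; rewrite e.
  - exact: h2.
have /choice[f fP] : forall i, exists j, (0 < i)%N ->
    exists q, [/\ q \in rho, q.1 = i.+1 :> nat & q.2 = j :> nat].
  move=> i; have [i0|i0] := posnP i; first by exists 0%N.
  by have [q qr q1] := col i i0; exists q.2 => _; exists q.
(* Outside the index range the row takes the default value 0. *)
pose s l := oapp f 0%N (insub l).
have sE i : s i = f i by rewrite /s valK.
have uniq_col q t : q \in rho -> t \in rho -> q.1 = t.1 :> nat -> q = t.
  by move=> qr tr e; apply: contrapT => ne; have [] := h2 _ _ qr tr ne; rewrite (val_inj e).
exists s.
  split=> [l hl|l l' l0 /andP[ll ln]].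
    have /andP[l0 ln] := hl; pose i := Ordinal ln; rewrite (sE i).
    have [//|q [qr q1 <-]] := fP i; have [_] := h1 _ qr.
    by rewrite q1 addnS subn1.
  have ln' := ltn_trans ll ln; rewrite (sE (Ordinal ln)) (sE (Ordinal ln')).
  have [|q [qr q1 <-]] := fP (Ordinal ln); first exact: ltn_trans ll.
  have [//|t [tr t1 <-]] := fP (Ordinal ln').
  move=> e2; have [|_ []] := h2 _ _ qr tr; last exact: val_inj.
  by move=> e; move: t1; rewrite -e q1 => -[] /= e'; move: ll; rewrite e' ltnn.
apply/setP => q; apply/idP/rooksP => [qr|[i [i0 q1 q2]]].
  have pre (m : nat) : (2 <= m <= n)%N -> [/\ m.-1 < n, 0 < m.-1 & m.-1.+1 = m]%N.
    by move=> h; split; lia.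
  have [/pre[iP i0 q1] _] := h1 _ qr; exists (Ordinal iP); split=> //.
  rewrite (sE (Ordinal iP)); have [//|t [tr t1 <-]] := fP (Ordinal iP).
  by rewrite (uniq_col _ _ qr tr) // t1.
have [//|t [tr t1 t2]] := fP i.
suff -> : q = t by [].
rewrite sE in q2; case: q t q1 q2 t1 t2 {tr} => a b [c d] /= e1 e2 e3 e4.
by congr pair; apply: val_inj; rewrite /= ?e1 ?e2 ?e3 ?e4.
Qed.

Lemma card_count_upto N P m : (m < N)%N ->
  #|[set j : 'I_N | (1 <= j <= m)%N && P (j : nat)]%SET| = count_upto P m.
Proof.
move=> mN; rewrite cardE -(size_map val) /count_upto -size_filter.
apply/perm_size/uniq_perm.
- by rewrite map_inj_uniq ?enum_uniq //; exact: val_inj.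
- by rewrite filter_uniq ?iota_uniq.
move=> j; rewrite mem_filter mem_iota; apply/mapP/andP.
  by move=> [l + ->]; rewrite mem_enum inE => /andP[hl Pl]; split=> //=; lia.
move=> [Pj hj]; have jN : (j < N)%N by lia.
by exists (Ordinal jN) => //; rewrite mem_enum inE /= Pj; lia.
Qed.

(** The squares counted by the rook word lie in one column, so their rows may be counted instead;
    the laser rows are those that are not [free]. *)
Lemma rook_wordE s i : valid s -> (0 < i)%N ->
  rook_word (rooks s) i = count_upto (free s i) (s i).
Proof.
move=> d i0; rewrite ffunE gtn_eqF //.
have /andP[s1 sn] : (1 <= s i <= n + i)%N by apply: d.1; rewrite i0 ltn_ord.
have sN : (s i < n.*2)%N by rewrite -addnn (leq_ltn_trans sn) // ltn_add2l.
have iN : (i.+1 < n.+1)%N by rewrite ltnS.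
rewrite -(card_count_upto _ sN).
pose f (j : 'I_n.*2) : square n := (Ordinal iN, j).
have f_inj : injective f by move=> j j' [].
rewrite -(card_imset _ f_inj); apply: eq_card => q.
have ltE (a b c : nat) : a = c.+1 -> b = i.+1 -> (a < b)%N = (c < i)%N by move=> -> ->.
rewrite inE; apply/andP/imsetP.
  move=> [+ /and3P[/eqP q1 nl /exists_inP[t /rooksP[l [l0 t1 t2]] /andP[/eqP e qt]]]].
  rewrite inE => /andP[_ /andP[b1 _]]; exists q.2; last first.
    by case: q q1 {e nl qt b1} => a b /= q1; congr pair; apply: val_inj.
  have il : l = i by apply: val_inj; move: t1; rewrite e q1 => -[].
  rewrite inE b1 -il -t2 qt /=; apply/freeP => c /andP[c0 ci] e2.
  have cn := ltn_trans ci (ltn_ord l).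
  have [|u [u1 u2]] := @square_exists (Ordinal cn) (s c).
    by have /andP[] := d.1 c (introT andP (conj c0 cn)).
  case/negP: nl; apply/existsP; exists u; apply/and3P; split.
  - by apply/rooksP; exists (Ordinal cn).
  - by rewrite (ltE _ _ _ u1 q1) -il.
  - by apply/eqP/val_inj; exact: etrans u2 e2.
move=> [j + ->]; rewrite inE => /andP[/andP[j1 js] fr]; split.
  by rewrite inE /= !ltnS i0 ltn_ord j1 addnS subn1 /= (leq_trans js).
rewrite eqxx /=; apply/andP; split.
  apply/existsP => -[t /and3P[/rooksP[l [l0 t1 t2]] lt /eqP e]].
  apply: (freeP _ _ _ fr l); last by rewrite -t2 e.
  by move: lt; rewrite t1 /= ltnS l0.
have [t [t1 t2]] := @square_exists i (s i) sn.
apply/existsP; exists t; apply/and3P; split; first by apply/rooksP; exists i.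
  by apply/eqP/val_inj.
by rewrite t2.
Qed.

Lemma rook_word_head s i : i = 0%N :> nat -> rook_word (rooks s) i = 1%N.
Proof. by move=> i0; rewrite ffunE i0. Qed.

Lemma valid_below s k : valid s -> (k <= n)%N -> distinct_below n s k.
Proof.
move=> [h1 h2] kn; split=> [l hl|l l' l0 hl]; first by apply: h1; lia.
by apply: h2; lia.
Qed.

Lemma valid_free s k : valid s -> (0 < k < n)%N -> free s k (s k).
Proof. by move=> [_ h2] hk; apply/freeP => l hl; apply: h2; lia. Qed.

Lemma rook_word_letters s : valid s -> letters (rook_word (rooks s)).
Proof.
move=> d i; have [i0|i0] := posnP i; first by rewrite rook_word_head.
rewrite rook_wordE //; have hi : (0 < i < n)%N by rewrite i0 ltn_ord.
have /andP[s0 sn] := d.1 _ hi; apply/andP; split.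
  apply: leq_ltn_trans (leq0n _) (count_upto_lt s0 (valid_free d hi)).
rewrite -(count_free i0 (valid_below d (ltnW (ltn_ord i)))).
exact: count_upto_le.
Qed.

(** From left to right: once the earlier rooks agree, so do the free rows, and distinct free rows
    have distinct counts. *)
Lemma rook_word_inj s s' : valid s -> valid s' ->
  rook_word (rooks s) = rook_word (rooks s') -> rooks s = rooks s'.
Proof.
move=> d d' e.
suff h k : (0 < k < n)%N -> s k = s' k.
  apply/setP => q; apply/rooksP/rooksP => -[i [i0 h1 h2]]; exists i; split=> //;
    by rewrite h2 h // i0 ltn_ord.
have [m km] := ubnP k; elim: m k km => // m IH k km hk.
have /andP[k0 kn] := hk; have /ffunP/(_ (Ordinal kn)) := e; rewrite !rook_wordE //=.
have sl l : (0 < l < k)%N -> s l = s' l by move=> hl; apply: IH; lia.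
have -> : free s k = free s' k.
  apply/funext => j; apply/freeP/freeP => h l hl; have := h l hl;
    by rewrite sl.
move=> c; case: (ltngtP (s k) (s' k)) => // lt.
  by have := count_upto_lt lt (valid_free d' hk); rewrite c ltnn.
have fk : free s' k (s k).
  by apply/freeP => l hl; rewrite -sl //; exact: freeP (valid_free d hk) l hl.
by have := count_upto_lt lt fk; rewrite c ltnn.
Qed.

(** Rooks are placed from left to right; by [count_free] each column offers [n + 1] free rows, one
    for each possible letter. *)
Lemma rook_word_surj w : letters w -> (forall i, i = 0%N :> nat -> w i = 1%N) ->
  exists2 s, valid s & rook_word (rooks s) = w.
Proof.
move=> lw w0; suff h k : (0 < k <= n)%N -> exists2 s, distinct_below n s k &
    forall i : 'I_n, (0 < i < k)%N -> count_upto (free s i) (s i) = w i.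
  have [n0|n0] := posnP n.
    exists id; last first.
      by apply/ffunP => i; exfalso; have := leq_ltn_trans (leq0n i) (ltn_ord i); rewrite n0.
    by split=> [l|l l']; rewrite n0 ltn0 andbF.
  have [|s d hs] := h n; first by rewrite n0 leqnn.
  exists s => //; apply/ffunP => i; have [i0|i0] := posnP i.
    by rewrite rook_word_head ?w0.
  by rewrite rook_wordE // hs // i0 ltn_ord.
elim: k => // k IH; have [-> _|k0 kn] := posnP k.
  by exists id; [split=> [l|l l']; lia|move=> i; lia].
have [|s d hs] := IH; first by rewrite k0 ltnW.
have {}kn : (k < n)%N by [].
have [|j [jr jf jc]] := @count_upto_surj (free s k) (n + k) (w (Ordinal kn)).
  by rewrite (count_free k0 d); have := lw (Ordinal kn).
pose s' l := if l == k then j else s l.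
have s'k : s' k = j by rewrite /s' eqxx.
have s'l l : (l < k)%N -> s' l = s l by move=> lk; rewrite /s' ltn_eqF.
have fE (i : nat) : (i <= k)%N -> free s' i = free s i.
  by move=> ik; apply/funext => b; apply/freeP/freeP => h l hl;
    move: (h l hl); rewrite s'l //; lia.
exists s'.
  split=> [l /andP[l0]|l l' l0 /andP[ll]]; rewrite ltnS leq_eqVlt => /predU1P[lk|lk].
  - by rewrite lk s'k.
  - by rewrite s'l //; apply: d.1; rewrite l0.
  - by rewrite lk s'k s'l -?lk //; apply: (freeP _ _ _ jf); lia.
  - by rewrite !s'l //; [apply: d.2; lia|lia].
move=> i /andP[i0]; rewrite ltnS leq_eqVlt => /predU1P[ik|ik].
  by rewrite ik s'k fE // jc; congr (w _); apply: val_inj.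
by rewrite s'l // fE ?(ltnW ik) // hs // i0.
Qed.

End Rooks.

(** * Regions of the Ish arrangement *)

Section IshData.
Context {n : nat} (o : 'I_n).
Implicit Types (p : {perm 'I_n}) (e : 'I_n -> nat) (s : nat -> nat) (a b i : 'I_n) (k : nat).

(** The combinatorial description of Ish ceiling diagrams. As [p a] is the label minus one,
    [e a <= p a] says that the level is less than the label. *)
Definition ish_data p e :=
  (forall a, (0 < e a)%N -> (p^-1%g o < a)%N /\ (e a <= p a)%N) /\
  (forall a b, (a < b)%N -> (0 < e a)%N -> (0 < e b)%N -> (e a < e b)%N).

Definition ish_row p e i : nat :=
  let j := p^-1%g i in if e j == 0%N then j.+1 else (n + e j)%N.

Lemma ish_data_inc p e a b : ish_data p e -> (0 < e a <= e b)%N -> (a <= b)%N.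
Proof.
move=> [_ h] /andP[ea eab]; rewrite leqNgt; apply/negP => ba.
by have := h _ _ ba (leq_trans ea eab) ea; rewrite ltnNge eab.
Qed.

Lemma ish_row_range p e i : ish_data p e -> (1 <= ish_row p e i <= n + i)%N.
Proof.
move=> [h _]; rewrite /ish_row; set j := p^-1%g i; have := ltn_ord j.
case: eqP => [_|/eqP]; first by move=> jn; rewrite /= (leq_trans jn) ?leq_addr.
rewrite -lt0n => ej jn; have [_] := h _ ej; rewrite permKV leq_add2l => ->.
by rewrite addn_gt0 ej orbT.
Qed.

Lemma ish_row_inj p e : ish_data p e -> injective (ish_row p e).
Proof.
move=> d i i'; rewrite /ish_row => h; apply: (can_inj (permKV p)); move: h.
set j := p^-1%g i; set j' := p^-1%g i'; have jn := ltn_ord j; have jn' := ltn_ord j'.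
have [ej|ej] := eqVneq (e j) 0%N; have [ej'|ej'] := eqVneq (e j') 0%N => /= h.
- by case: h => /val_inj.
- by lia.
- by lia.
have ee := addnI h; rewrite -lt0n in ej.
apply/val_inj/anti_leq/andP; split; apply: (ish_data_inc d);
  by rewrite -?ee ej leqnn.
Qed.

Lemma ish_row_eps p e i : e (p^-1%g i) = (ish_row p e i - n)%N.
Proof.
rewrite /ish_row; case: eqP => [->|_]; last by rewrite addKn.
by apply/esym/eqP; rewrite subn_eq0.
Qed.

Lemma ish_data_o p e : ish_data p e -> e (p^-1%g o) = 0%N.
Proof. by move=> [h _]; have [//|/h[]] := posnP (e (p^-1%g o)); rewrite ltnn. Qed.

(** The rows give each label its level, and also its position when the level is 0. At the first
    position where [p] and [p'] differ, each of the two labels comes later in the other permutation;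
    this is impossible, because positive levels lie right of [o] and increase. *)
Lemma ish_data_inj p e p' e' : ish_data p e -> ish_data p' e' ->
  (forall i, i != o -> ish_row p e i = ish_row p' e' i) -> p = p' /\ e = e'.
Proof.
move=> d d' row.
have eE i : e (p^-1%g i) = e' (p'^-1%g i).
  have [->|io] := eqVneq i o; first by rewrite !ish_data_o.
  by rewrite !ish_row_eps row.
have pE i : i != o -> e (p^-1%g i) = 0%N -> p^-1%g i = p'^-1%g i.
  move=> io e0; have := row i io; rewrite /ish_row -eE e0 /= => -[].
  exact: val_inj.
have pp' a : p a = p' a.
  have [m am] := ubnP (a : nat); elim: m a am => // m IH a am.
  have IH' b : (b < a)%N -> p b = p' b by move=> ba; apply: IH; exact: leq_trans ba _.
  set l := p a; set l' := p' a; apply: contrapT => ne.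
  have pl : p^-1%g l = a by rewrite permK.
  have pl' : p'^-1%g l' = a by rewrite permK.
  have lt' : (a < p'^-1%g l)%N.
    case: (ltngtP a (p'^-1%g l)) => // [ta|/val_inj ta].
      have := IH' _ ta; rewrite permKV -[RHS]/(p a) => /perm_inj ta'.
      by move: ta; rewrite ta' ltnn.
    by case: ne; rewrite /l' ta permKV.
  have lt : (a < p^-1%g l')%N.
    case: (ltngtP a (p^-1%g l')) => // [ta|/val_inj ta].
      have := IH' _ ta; rewrite permKV -[LHS]/(p' a) => /perm_inj ta'.
      by move: ta; rewrite -ta' ltnn.
    by case: ne; rewrite /l ta permKV.
  have [lo|lo] := posnP (e (p^-1%g l)).
    have [lo'|lo'] := posnP (e (p^-1%g l')).
      have hl : l = o.
        apply: contrapT => /eqP h; have h' := pE _ h lo.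
        by move: lt'; rewrite -h' pl ltnn.
      have hl' : l' = o.
        apply: contrapT => /eqP h; have h' := pE _ h lo'.
        by move: lt; rewrite h' pl' ltnn.
      by case: ne; rewrite hl hl'.
    have hl : l = o.
      apply: contrapT => /eqP h; have h' := pE _ h lo.
      by move: lt'; rewrite -h' pl ltnn.
    rewrite eE pl' in lo'; have [h _] := d'.1 _ lo'.
    by move: (ltn_trans h lt'); rewrite hl ltnn.
  have [lo'|lo'] := posnP (e (p^-1%g l')).
    have hl' : l' = o.
      apply: contrapT => /eqP h; have h' := pE _ h lo'.
      by move: lt; rewrite h' pl' ltnn.
    rewrite pl in lo; have [h _] := d.1 _ lo.
    by move: (ltn_trans h lt); rewrite hl' ltnn.
  have h1 : (e (p^-1%g l) < e (p^-1%g l'))%N by apply: d.2 => //; rewrite pl.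
  have h2 : (e' (p'^-1%g l') < e' (p'^-1%g l))%N by apply: d'.2; rewrite -?eE // pl'.
  by move: h1; rewrite !eE ltnNge ltnW.
have ppE : p = p' by apply/permP.
split=> //; apply/funext => a; have := eE (p a); by rewrite -ppE permK.
Qed.

Hypothesis o0 : o = 0%N :> nat.

(** Rows at most [n] prescribe positions. The labels of [S], with [o] given level 0, fill the
    remaining positions in the order of their levels, so that [o] precedes all positive levels. *)
Lemma ish_data_exists s : valid s (n := n) ->
  exists p e, ish_data p e /\ forall i, i != o -> ish_row p e i = s i.
Proof.
move=> d; have [s1 s2] := d.
pose kap i := if i == o then 0%N else (s i - n)%N.
pose S := [set i | (i == o) || (n < s i)%N]%SET.
have posi i : i != o -> (0 < i < n)%N.
  by move=> io; rewrite ltn_ord andbT lt0n -o0; apply: contra io => /eqP/val_inj ->.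
have s_inj i i' : i != o -> i' != o -> s i = s i' -> i = i'.
  by move=> /posi hi /posi hi' /(distinct_below_inj d hi hi') /val_inj.
have kap_inj : {in S &, injective kap}.
  move=> i i'; rewrite !inE /kap; case: eqVneq => [->|io]; case: eqVneq => [->|io'] //=; try lia.
  by move=> h h' e; apply: s_inj => //; lia.
pose taken := [seq (s i).-1 | i <- enum (~: S)%SET].
pose P := [seq a <- iota 0 n | a \notin taken].
have takenP i : i \notin S -> [/\ i != o, (0 < s i <= n)%N & ((s i).-1 < n)%N].
  rewrite inE negb_or -leqNgt => /andP[io sn]; have /andP[h _] := s1 _ (posi _ io).
  by split=> //; lia.
have sP : size P = #|S|.
  have taken_uniq : uniq taken.
    rewrite map_inj_in_uniq ?enum_uniq // => i i'; rewrite !mem_enum !finset.in_setC => /takenP[io h1 _] /takenP[io' h2 _] e; apply: s_inj => //; lia.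
  have := count_predC (mem taken) (iota 0 n); rewrite size_iota -!size_filter.
  have -> : size [seq a <- iota 0 n | mem taken a] = size taken.
    apply/perm_size/uniq_perm => //; first by rewrite filter_uniq ?iota_uniq.
    move=> a; rewrite mem_filter mem_iota /=; case: (boolP (a \in taken)) => //= /mapP[i].
    by rewrite mem_enum finset.in_setC => /takenP[_ _ h] ->.
  rewrite size_map -cardE; have := cardsC S; rewrite card_ord.
  have -> : [seq a <- iota 0 n | (predC (mem taken)) a] = P by [].
  lia.
(* The rank of the level of [i] within [S], which is the index in [P] of its position. *)
pose r i := #|[set j in S | (kap j < kap i)%N]%SET|.
have r_lt i : i \in S -> (r i < #|S|)%N.
  move=> iS; apply: proper_card; apply/properP; split.
    by apply/fintype.subsetP => j; rewrite inE => /andP[].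
  by exists i => //; rewrite !inE ltnn andbF.
have r_mono i j : i \in S -> (kap i < kap j)%N -> (r i < r j)%N.
  move=> iS ij; apply: proper_card; apply/properP; split.
    apply/fintype.subsetP => l; rewrite !inE => /andP[-> li] /=; exact: ltn_trans li ij.
  by exists i; rewrite !inE ?ltnn ?andbF // ij andbT; move: iS; rewrite inE.
have sortedP : sorted ltn P by apply: sorted_filter (iota_ltn_sorted _ _); exact: ltn_trans.
pose tau_nat i := if i \in S then nth 0%N P (r i) else (s i).-1.
have tau_lt i : (tau_nat i < n)%N.
  rewrite /tau_nat; case: ifP => [iS|/negbT/takenP[]//].
  have : nth 0%N P (r i) \in P by rewrite mem_nth // sP r_lt.
  by rewrite mem_filter mem_iota => /andP[_].
have tau_mono i j : i \in S -> j \in S -> (kap i < kap j)%N -> (tau_nat i < tau_nat j)%N.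
  move=> iS jS ij; rewrite /tau_nat iS jS.
  by apply: (sorted_ltn_nth ltn_trans) => //; rewrite ?inE ?sP ?r_lt ?r_mono.
pose tau i := Ordinal (tau_lt i).
have tau_inj : injective tau.
  move=> i j [] e; have mix i' j' : i' \in S -> j' \notin S -> tau_nat i' <> tau_nat j'.
    move=> iS jS; rewrite /tau_nat iS (negPf jS) => e'.
    have : nth 0%N P (r i') \in P by rewrite mem_nth // sP r_lt.
    rewrite e' mem_filter => /andP[/mapP[]]; exists j' => //.
    by rewrite mem_enum finset.in_setC.
  case: (boolP (i \in S)) (boolP (j \in S)) => iS [] jS.
  - apply: kap_inj => //; case: (ltngtP (kap i) (kap j)) => // /tau_mono h.
      by have := h iS jS; rewrite e ltnn.
    by have := h jS iS; rewrite e ltnn.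
  - by case: (mix i j).
  - by case: (mix j i).
  - move: e; rewrite /tau_nat (negPf iS) (negPf jS).
    have [io h1 _] := takenP _ iS; have [jo h2 _] := takenP _ jS.
    by move=> e; apply: s_inj => //; lia.
pose p := (perm tau_inj)^-1%g.
have pV i : p^-1%g i = tau i by rewrite /p invgK permE.
have kapS i : (0 < kap i)%N -> [/\ i \in S, i != o & kap i = (s i - n)%N].
  rewrite inE /kap; case: eqVneq => //= io h; split=> //; lia.
have oS : o \in S by rewrite inE eqxx.
have kapo : kap o = 0%N by rewrite /kap eqxx.
have tauK a : tau (p a) = a by rewrite -pV permK.
exists p, (fun a => kap (p a)); split; first split.
- move=> a ka; have [aS ao e] := kapS _ ka; split.
    by rewrite pV -[a in X in (_ < X)%N]tauK; apply: tau_mono => //; rewrite kapo.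
  by rewrite e leq_subLR; have /andP[_] := s1 _ (posi _ ao).
- move=> a b ab ka kb; have [aS _ _] := kapS _ ka; have [bS _ _] := kapS _ kb.
  case: (ltngtP (kap (p a)) (kap (p b))) => // [h|h].
    have := tau_mono _ _ bS aS h; rewrite -[tau_nat _]/(val (tau (p b))).
    rewrite -[tau_nat _]/(val (tau (p a))) !tauK /= => h'.
    by move: (ltn_trans ab h'); rewrite ltnn.
  by move: ab; rewrite (perm_inj (kap_inj _ _ aS bS h)) ltnn.
move=> i io; rewrite /ish_row permKV pV /= /tau_nat inE /kap (negPf io) /=.
have /andP[s0 _] := s1 _ (posi _ io); rewrite subn_eq0 leqNgt.
by case: ltnP => [ns|_] /=; [rewrite subnKC // ltnW|rewrite prednK].
Qed.

End IshData.

(** * Ceiling levels and Ish regions *)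

Section Ish.
Context {R : realType} {n : nat} (o : 'I_n).
Hypothesis o0 : o = 0%N :> nat.
Implicit Types (x y : 'rV[R]_n) (p : {perm 'I_n}) (a b c i j : 'I_n) (k : nat).

(** Labels are ordinals plus one, so [k <= j] keeps the offset below the label of [j]. *)
Definition ish_triple i j k := (i < j)%N && ((k == 0%N) || ((i == o) && (k <= j)%N)).

Lemma Ish_arrangement : Ish R n = arrangement ish_triple.
Proof.
apply/seteqP; split=> H.
  move=> [q0 [i [j [q00 ij h]]]]; have oo : q0 = o by apply: val_inj; rewrite /= o0.
  case: h => [] ->; first by exists i, j, 0%N; rewrite /ish_triple ij eqxx.
  exists q0, j, i.+1; split=> //; rewrite /ish_triple oo eqxx ij o0 orbT andbT.
  exact: leq_ltn_trans ij.
move=> [i [j [k [/andP[ij h] ->]]]]; case: k h => [_|k /= /andP[/eqP io kj]].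
  by exists o, i, j; split=> //; left.
exists o, (Ordinal (ltn_trans kj (ltn_ord j))), j; split=> //.
by rewrite io; right.
Qed.

Lemma ish_triple_bound i j k : ish_triple i j k -> (i < j)%N /\ (k <= n)%N.
Proof.
move=> /andP[ij /orP[/eqP ->//|/andP[_ kj]]]; split=> //.
exact: leq_trans kj (ltnW (ltn_ord j)).
Qed.

Lemma ish_triple0 i j : (i < j)%N -> ish_triple i j 0.
Proof. by rewrite /ish_triple => ->. Qed.

Lemma ish_tripleo j k : (0 < k <= j)%N -> ish_triple o j k.
Proof. by move=> /andP[k0 kj]; rewrite /ish_triple o0 (leq_trans k0 kj) eqxx kj orbT. Qed.

Lemma ish_triple_pos i j k : ish_triple i j k -> (0 < k)%N -> i = o /\ (k <= j)%N.
Proof.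
by move=> /andP[_ /orP[/eqP ->//|/andP[/eqP -> kj]]].
Qed.

Lemma dist_le0 x p a : sorting x p -> (a <= p^-1%g o)%N -> dif x o (p a) <= 0.
Proof.
move=> sx az; rewrite -{1}(permKV p o) /dif subr_le0; move: az.
by rewrite leq_eqVlt => /predU1P[/val_inj ->|/sx/ltW].
Qed.

Lemma dist_gt0 x p a : sorting x p -> (p^-1%g o < a)%N -> 0 < dif x o (p a).
Proof. by move=> sx az; rewrite -{1}(permKV p o) /dif subr_gt0; exact: sx. Qed.

Lemma dist_le x p a b : sorting x p -> (a <= b)%N -> dif x o (p a) <= dif x o (p b).
Proof.
by move=> sx ab; rewrite -{1 2}(permKV p o); apply: sorting_dif_le.
Qed.

(* The distances to x_1 sit in the unit intervals prescribed by u, spread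
   according to their positions. *)
Lemma ish_point p (u : 'I_n -> nat) :
  (forall a, (p^-1%g o < a)%N -> (0 < u a)%N) ->
  (forall a b, (p^-1%g o < a)%N -> (a <= b)%N -> (u a <= u b)%N) ->
  exists y, [/\ sorting y p, generic ish_triple y &
    forall a k, (p^-1%g o < a)%N -> (dif y o (p a) < k%:R) = (u a <= k)%N].
Proof.
move=> u0 u_mono; set z := p^-1%g o.
pose fr a : R := a.+1%:R / n.+1%:R.
have n1 : 0 < n.+1%:R :> R by rewrite ltr0n.
have fr0 a : 0 < fr a by rewrite divr_gt0 ?ltr0n.
have fr1 a : fr a < 1 by rewrite ltr_pdivrMr // mul1r ltr_nat ltnS.
have fr_lt a b : (a < b)%N -> fr a < fr b.
  by move=> ab; rewrite ltr_pM2r ?invr_gt0 // ltr_nat.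
pose d a : R := if (a <= z)%N then a%:R - z%:R else (u a)%:R - 1 + fr a.
have dz : d z = 0 by rewrite /d leqnn subrr.
have d_le a : (a <= z)%N -> d a <= 0 by move=> az; rewrite /d az subr_le0 ler_nat.
have d_gt a : (z < a)%N -> d a = (u a)%:R - 1 + fr a by move=> za; rewrite /d leqNgt za.
have d_gt0 a : (z < a)%N -> 0 < d a.
  move=> za; rewrite d_gt //; have := fr0 a.
  have : 1 <= (u a)%:R :> R by rewrite ler1n u0.
  lra.
have d_lt a b : (a < b)%N -> d a < d b.
  move=> ab; case: (leqP b z) => bz.
    by rewrite /d bz (leq_trans (ltnW ab) bz) ltrD2r ltr_nat.
  case: (leqP a z) => az; first exact: le_lt_trans (d_le _ az) (d_gt0 _ bz).
  rewrite !d_gt //; have := fr_lt _ _ ab.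
  have : (u a)%:R <= (u b)%:R :> R by rewrite ler_nat u_mono // ltnW.
  lra.
pose y : 'rV[R]_n := \row_l - d (p^-1%g l).
have yE a b : dif y (p a) (p b) = d b - d a by rewrite /dif !mxE !permK; lra.
have yo a : dif y o (p a) = d a by rewrite -{1}(permKV p o) yE dz subr0.
have sy : sorting y p by move=> a b /d_lt; rewrite !mxE !permK ltrN2.
have key a k : (z < a)%N ->
    (d a < k%:R) = (u a <= k)%N /\ d a != k%:R.
  move=> za; rewrite d_gt //; have f0 := fr0 a; have f1 := fr1 a; case: leqP => uk.
    have : (u a)%:R <= k%:R :> R by rewrite ler_nat.
    move=> h; have h' : (u a)%:R - 1 + fr a < k%:R by lra.
    by rewrite h' lt_eqF.
  have : k.+1%:R <= (u a)%:R :> R by rewrite ler_nat.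
  rewrite -natr1 => h; have h' : k%:R < (u a)%:R - 1 + fr a by lra.
  by rewrite gt_eqF // ltNge ltW.
exists y; split=> // [i j k t|a k za]; last by rewrite yo; have [] := key a k za.
have [->|k0] := posnP k.
  have [ij _] := ish_triple_bound t; rewrite subr_eq0; apply/eqP => e.
  have := sortingVE i j sy; have := sortingVE j i sy; rewrite e ltxx.
  case: (ltngtP (p^-1%g i) (p^-1%g j)) => // /val_inj/perm_inj h.
  by move: ij; rewrite h ltnn.
have [-> kj] := ish_triple_pos t k0; rewrite -[j](permKV p) yo.
case: (leqP (p^-1%g j) z) => jz; last by have [] := key _ k jz.
by rewrite lt_eqF // (le_lt_trans (d_le _ jz)) // ltr0n.
Qed.

Section Region.
Variables (x : 'rV[R]_n) (p : {perm 'I_n}).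
Hypotheses (gx : generic ish_triple x) (sx : sorting x p).
Let D := cell ish_triple x.
Let ceil a k := ceiling (Ish R n) D (diff_hyp o (p a) k%:R).

Let region_permE : region_perm D = p.
Proof. exact: region_perm_cell ish_triple0 _ _ gx sx. Qed.

Let ceilP a k : ceil a k -> [/\ (0 < k <= p a)%N, (p^-1%g o < a)%N,
  dif x o (p a) < k%:R & exists2 q, sorting q p & touches ish_triple x o (p a) k q].
Proof.
rewrite /ceil Ish_arrangement => h.
have [t k0] := ceiling_mem ish_triple_bound h.
have [xk [q tq]] := ceiling_touches ish_triple_bound gx t k0 h; have [qk qn] := tq.
have sq : sorting q p.
  apply: sorting_same sx => i j /ish_triple0 ij; apply: (qn _ _ _ ij) => -[_ _ e].
  by move: k0; rewrite -e.
have [_ kj] := ish_triple_pos t k0; split=> //; [by rewrite k0| |by exists q].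
rewrite ltnNge; apply/negP => /(dist_le0 sq).
by rewrite qk leNgt ltr0n k0.
Qed.

(** A point touching the larger level would exceed the smaller one, which it must respect as [x]
    does. *)
Let ceil_uniq a k k' : ceil a k -> ceil a k' -> (k <= k')%N.
Proof.
move=> /ceilP[hk _ xk [q _ [qk qn]]] /ceilP[hk' _ xk' _]; rewrite leqNgt; apply/negP => kk.
have [|_ h] := qn _ _ _ (ish_tripleo hk'); first by move=> [e]; move: kk; rewrite e ltnn.
by move: h; rewrite xk' qk ltr_nat ltnNge ltnW.
Qed.

Let eps_ceil a : (0 < ish_eps D a)%N -> ceil a (ish_eps D a).
Proof.
rewrite /ish_eps region_permE; case: xgetP => [k _ /= [q0 q00 h] _|_]; last by rewrite ltnn.
have qo : q0 = o by apply: val_inj; rewrite /= o0.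
by rewrite qo in h.
Qed.

Let ceil_eps a k : ceil a k -> ish_eps D a = k.
Proof.
move=> ck; have ce : ceil a (ish_eps D a).
  rewrite /ish_eps region_permE; case: xgetP => [k' _ /= [q0 q00 h]|h].
    have qo : q0 = o by apply: val_inj; rewrite /= o0.
    by rewrite qo in h.
  by exfalso; apply: (h k); exists o.
by apply/anti_leq; rewrite (ceil_uniq ce ck) (ceil_uniq ck ce).
Qed.

(** At a point touching the level of [a], a position further right is at least as far from [x_1],
    yet strictly within its own level. *)
Lemma ish_eps_data : ish_data o p (ish_eps D).
Proof.
split=> [a /eps_ceil/ceilP[/andP[_ h] za _ _] //|a b ab /eps_ceil ca /eps_ceil cb].
have [_ _ _ [q sq [qk qn]]] := ceilP ca; have [hb _ xb _] := ceilP cb.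
rewrite ltnNge; apply/negP => ba.
have [|_ h] := qn _ _ _ (ish_tripleo hb).
  by move=> [/perm_inj e _]; move: ab; rewrite e ltnn.
have : dif q o (p b) < (ish_eps D b)%:R by rewrite h.
apply/negP; rewrite -leNgt; apply: le_trans (dist_le sq (ltnW ab)).
by rewrite qk ler_nat.
Qed.

(** Distances to [x_1] grow with the position, so a ceiling further right bounds them. Conversely,
    among the positions from [a] on that are bounded by the least level above [a] and whose label
    admits this level, the last one has it as a ceiling. *)
Lemma ish_dist a k : (p^-1%g o < a)%N -> (0 < k <= p a)%N ->
  dif x o (p a) < k%:R <-> exists2 b : 'I_n, (a <= b)%N & (0 < ish_eps D b <= k)%N.
Proof.
move=> za /andP[k0 ka]; split=> [xk|[b ab /andP[e0 ek]]]; last first.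
  have [_ _ h _] := ceilP (eps_ceil e0).
  apply: le_lt_trans (dist_le sx ab) _; apply: lt_le_trans h _.
  by rewrite ler_nat.
(* Right of [o], this is the least integer above the distance of position [b]. *)
pose u b := (Num.truncn (dif x o (p b))).+1.
have uE b m : (p^-1%g o < b)%N -> (dif x o (p b) < m%:R) = (u b <= m)%N.
  by move=> zb; rewrite -truncn_lt_nat // ltW // dist_gt0.
have u_mono b b' : (b <= b')%N -> (u b <= u b')%N.
  by move=> bb; rewrite ltnS; apply: le_truncn; exact: dist_le.
have uak : (u a <= k)%N by rewrite -uE.
pose P b := [&& a <= b, u b <= u a & u a <= p b]%N.
have Pa : P a by rewrite /P !leqnn (leq_trans uak).
case: (arg_maxnP (fun b : 'I_n => b : nat) Pa) => c /and3P[ac uca uc] cmax.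
have zc := leq_trans za ac.
(* From [c] on, distances are pushed beyond [u a]; earlier ones keep their unit interval. *)
pose u' b := if (c <= b)%N then maxn (u b) (u a).+1 else u b.
have [| |y [sy gy yE]] := @ish_point p u'.
- by move=> b _; rewrite /u'; case: ifP => _; rewrite ?leq_max.
- move=> b b' _ bb; have := u_mono _ _ bb; rewrite /u'; case: ifP => cb.
    by rewrite (leq_trans cb bb); lia.
  by case: ifP => _; lia.
suff cc : ceil c (u a) by exists c => //; rewrite (ceil_eps cc).
have tc : ish_triple o (p c) (u a) by apply: ish_tripleo.
rewrite /ceil Ish_arrangement.
apply: (ceiling_flip ish_triple_bound (y := y)) => //.
- by rewrite uE.
- rewrite lt_neqAle eq_sym gy //= leNgt yE // /u' leqnn -ltnNge.
  by rewrite leq_max ltnSn orbT.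
move=> i j m t ne; split; first exact: gy.
have [m0|m0] := posnP m.
  by rewrite m0 /dif !subr_lt0 (sortingVE _ _ sx) (sortingVE _ _ sy).
have [io mj] := ish_triple_pos t m0; rewrite io -[j](permKV p) in ne *.
rewrite -[j](permKV p) in mj; set b := p^-1%g j in ne mj *.
case: (leqP b (p^-1%g o)) => bz.
  have neg (v : 'rV[R]_n) : sorting v p -> dif v o (p b) < m%:R.
    by move=> sv; rewrite (le_lt_trans (dist_le0 sv bz)) // ltr0n.
  by rewrite !neg.
rewrite yE // uE // /u'; case: ifP => // cb; rewrite geq_max.
(* Another hyperplane crossed would have level [u a] and a position satisfying [P], so by the choice
   of [c] it would be that of [c]. *)
have [ubm|//] := leqP (u b) m; rewrite /= ltnNge; apply/negP => mua.
have aub := u_mono _ _ (leq_trans ac cb).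
have mE : m = u a by lia.
have Pb : P b by rewrite /P (leq_trans ac cb) -mE ubm.
have bc' : (b <= c)%N := cmax _ Pb.
have bc : b = c by apply/val_inj/anti_leq; rewrite cb bc'.
by apply: ne; rewrite bc mE.
Qed.

End Region.

(** From a level of [e] at [b], pass to a level of [e'] that is no larger and no further left, then
    back to one of [e]. As levels increase, this ends at [b], and all the levels are equal. *)
Lemma ish_data_determined p (e e' : 'I_n -> nat) : ish_data o p e -> ish_data o p e' ->
  (forall a k, (p^-1%g o < a)%N -> (0 < k <= p a)%N ->
    (exists2 b : 'I_n, (a <= b)%N & (0 < e b <= k)%N) <->
    (exists2 b : 'I_n, (a <= b)%N & (0 < e' b <= k)%N)) -> e = e'.
Proof.
have half (f f' : 'I_n -> nat) b : ish_data o p f -> ish_data o p f' ->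
  (forall a k, (p^-1%g o < a)%N -> (0 < k <= p a)%N ->
    (exists2 b : 'I_n, (a <= b)%N & (0 < f b <= k)%N) <->
    (exists2 b : 'I_n, (a <= b)%N & (0 < f' b <= k)%N)) -> (0 < f b)%N -> f' b = f b.
  move=> d d' h fb; have [zb bp] := d.1 _ fb.
  have hb : (0 < f b <= p b)%N by rewrite fb.
  have [|c bc /andP[c0 cf]] := (h b (f b) zb hb).1; first by exists b; rewrite ?fb leqnn.
  have [zc cp] := d'.1 _ c0.
  have hc : (0 < f' c <= p c)%N by rewrite c0.
  have [|g cg /andP[g0 gf]] := (h c (f' c) zc hc).2; first by exists c; rewrite ?c0 leqnn.
  have gb : (g <= b)%N by apply: (ish_data_inc d); rewrite g0 (leq_trans gf cf).
  have gE : g = b by apply/val_inj/anti_leq; rewrite gb (leq_trans bc cg).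
  have cE : c = b by apply/val_inj/anti_leq; rewrite bc -gE cg.
  rewrite cE in cf gf; rewrite gE in gf; by apply/anti_leq; rewrite cf gf.
move=> d d' h; apply/funext => b; have [b0|b0] := posnP (e b); last first.
  by rewrite (half e e').
have [->//|b0'] := posnP (e' b).
by rewrite -(half e' e) // => a k za ka; split=> /(h a k za ka).
Qed.

(** Each distance right of [o] is put in the unit interval just below the least level at or right of
    its position. *)
Lemma ish_data_realize p (e : 'I_n -> nat) : ish_data o p e ->
  exists x, [/\ sorting x p, generic ish_triple x & ish_eps (cell ish_triple x) = e].
Proof.
move=> d; have /choice[u uP] : forall a, exists m, [/\ (0 < m)%N, (m <= n.+1)%N &
    forall k, (k <= n)%N -> (m <= k)%N <-> exists2 b : 'I_n, (a <= b)%N & (0 < e b <= k)%N].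
  (* The witness is the least level at or right of [a], or [n + 1] if there is none. *)
  move=> a; pose Q m := (m == n.+1) || [exists b : 'I_n, [&& a <= b, 0 < e b & e b == m]]%N.
  have exQ : exists m, Q m by exists n.+1; rewrite /Q eqxx.
  case: (ex_minnP exQ) => m Qm mmin; exists m; split.
  - by case/orP: Qm => [/eqP ->//|/existsP[b /and3P[_ eb /eqP <-]]].
  - by apply: mmin; rewrite /Q eqxx.
  move=> k kn; split=> [mk|[b ab /andP[b0 bk]]].
    case/orP: Qm => [/eqP e1|/existsP[b /and3P[ab eb /eqP e1]]].
      by move: mk; rewrite e1 leqNgt ltnS kn.
    by exists b; rewrite ?eb ?e1.
  apply: leq_trans bk; apply: mmin; apply/orP; right; apply/existsP; exists b.
  by rewrite ab b0 eqxx.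
have [| |x [sx gx xE]] := @ish_point p u.
- by move=> a _; have [] := uP a.
- move=> a b _ ab; have [_ ua ha] := uP a; have [_ ub hb] := uP b.
  have [un|nu] := leqP (u b) n; last exact: leq_trans ua nu.
  apply/(ha _ un); have [c bc hc] := (hb _ un).1 (leqnn _).
  by exists c; rewrite ?(leq_trans ab).
exists x; split=> //; apply: (ish_data_determined (ish_eps_data gx sx) d).
move=> a k za ka; have [_ _ ha] := uP a; have kn : (k <= n)%N.
  by case/andP: ka => _ ka; exact: leq_trans ka (ltnW (ltn_ord _)).
by rewrite -(ha _ kn) -xE //; apply: iff_sym; exact: ish_dist.
Qed.

Lemma ish_cell_eq x y p : generic ish_triple x -> generic ish_triple y ->
  sorting x p -> sorting y p ->
  ish_eps (cell ish_triple x) = ish_eps (cell ish_triple y) ->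
  cell ish_triple x = cell ish_triple y.
Proof.
move=> gx gy sx sy ee; apply: cell_eq => i j k t; split; first exact: gy.
have [k0|k0] := posnP k.
  by rewrite k0 /dif !subr_lt0 (sortingVE _ _ sx) (sortingVE _ _ sy).
have [-> kj] := ish_triple_pos t k0; rewrite -[j](permKV p) in kj *.
set a := p^-1%g j in kj *; case: (leqP a (p^-1%g o)) => az.
  have neg (v : 'rV[R]_n) : sorting v p -> dif v o (p a) < k%:R.
    by move=> sv; rewrite (le_lt_trans (dist_le0 sv az)) // ltr0n.
  by rewrite !neg.
have ka : (0 < k <= p a)%N by rewrite k0.
have ex := ish_dist gx sx az ka; have ey := ish_dist gy sy az ka; rewrite ee in ex.
by apply/idP/idP => [/ey/ex|/ex/ey].
Qed.

Lemma ish_rooksE (D : set 'rV[R]_n) (s : nat -> nat) :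
  (forall i, i != o -> ish_row (region_perm D) (ish_eps D) i = s i) ->
  ish_rooks D = rooks s.
Proof.
move=> h; apply/setP => q; rewrite !inE; apply: eq_existsb => i /=.
case: posnP => //= i0; rewrite -h //.
by apply/eqP => e; move: i0; rewrite e o0.
Qed.

Lemma ish_rooks_bij : set_bij (regions (Ish R n))
  [set rho | maximal_rook_placement rho] (@ish_rooks R n).
Proof.
have nat_ext (f : 'I_n -> nat) : exists s : nat -> nat, forall i, f i = s i.
  by exists (fun l => oapp f 0%N (insub l)) => i; rewrite valK.
have o_pos i : (0 < i)%N -> i != o by move=> i0; apply/eqP => e; move: i0; rewrite e o0.
rewrite Ish_arrangement regions_arrangement; split.
- move=> _ [x gx <-]; have [p sx] := generic_sorting ish_triple0 gx.
  have d := ish_eps_data gx sx; set D := cell _ x in d *.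
  have pE : region_perm D = p by exact: region_perm_cell ish_triple0 _ _ gx sx.
  have [s sE] := nat_ext (ish_row p (ish_eps D)).
  rewrite /= (@ish_rooksE _ s); last by move=> i _; rewrite pE.
  apply: rooks_maximal; split=> [l hl|l l' l0 hl].
    have /andP[_ ln] := hl; have := ish_row_range (Ordinal ln) d; by rewrite sE.
  have ln' : (l' < n)%N by case/andP: hl.
  have ln : (l < n)%N by case/andP: hl => h _; exact: ltn_trans h ln'.
  move=> e; have := @ish_row_inj _ _ _ _ d (Ordinal ln) (Ordinal ln').
  rewrite !sE /= => /(_ e) [e']; by move: hl; rewrite e' ltnn.
- move=> C C'; rewrite !inE => -[x gx <-] [y gy <-] e.
  have [p sx] := generic_sorting ish_triple0 gx.
  have [q sy] := generic_sorting ish_triple0 gy.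
  have dx := ish_eps_data gx sx; have dy := ish_eps_data gy sy.
  have [s sE] := nat_ext (ish_row p (ish_eps (cell ish_triple x))).
  have [s' s'E] := nat_ext (ish_row q (ish_eps (cell ish_triple y))).
  have px : region_perm (cell ish_triple x) = p by exact: region_perm_cell ish_triple0 _ _ gx sx.
  have py : region_perm (cell ish_triple y) = q by exact: region_perm_cell ish_triple0 _ _ gy sy.
  (* Column [i + 1] contains a single rook, so equal placements have equal rows. *)
  have rowE i : i != o -> ish_row p (ish_eps (cell ish_triple x)) i =
      ish_row q (ish_eps (cell ish_triple y)) i.
    move=> io; rewrite sE s'E; have i0 : (0 < i)%N.
      by rewrite lt0n -o0; apply: contra io => /eqP/val_inj ->.
    have si : (s i <= n + i)%N.
      by rewrite -sE; have /andP[] := ish_row_range i dx.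
    have [t [t1 t2]] := square_exists si.
    have : t \in rooks s by apply/rooksP; exists i.
    rewrite -(@ish_rooksE (cell ish_triple x)) ?e; last by move=> j _; rewrite px.
    rewrite (@ish_rooksE _ s'); last by move=> j _; rewrite py.
    move=> /rooksP[j [j0 u1 u2]]; rewrite -t2 u2.
    by have -> : j = i by apply: val_inj; move: u1; rewrite t1 => -[].
  have [pq ee] := ish_data_inj dx dy rowE; rewrite -pq in sy.
  exact: ish_cell_eq gx gy sx sy ee.
- move=> rho /maximal_rooks[s vs ->].
  have [p [e [d rowE]]] := ish_data_exists o0 vs.
  have [x [sx gx epsE]] := ish_data_realize d.
  exists (cell ish_triple x); first by exists x.
  apply: ish_rooksE => i io; rewrite epsE (region_perm_cell ish_triple0 gx sx).
  exact: rowE.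
Qed.

End Ish.

(** * From rook placements to parking functions *)

Section Alpha.
Context {n : nat} (o : 'I_n).
Hypothesis o0 : o = 0%N :> nat.

Lemma alpha_bij : set_bij [set rho : {set square n} | maximal_rook_placement rho]
  [set w | parking w] alpha.
Proof.
split.
- by move=> _ /maximal_rooks[s vs ->]; have [] := alphaP (rook_word_letters vs).
- move=> rho rho'; rewrite !inE => /maximal_rooks[s vs ->] /maximal_rooks[s' vs' ->] e.
  have lw := rook_word_letters vs; have lw' := rook_word_letters vs'.
  have [_ [k ak]] := alphaP lw; have [_ [k' ak']] := alphaP lw'.
  (* Both rook words start with 1 and have a common shift. *)
  apply: rook_word_inj => //; apply: (orbit_head (i0 := o) (k := k) (k' := k') lw lw').
    by rewrite !rook_word_head.
  by rewrite -ak -ak'.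
- move=> p /= pp; have lp : letters p.
    by move=> i; have /andP[-> h] := pp.1 i; exact: leq_trans h (leqnSn n).
  (* Shifting the parking function until its first letter is 1 makes it a rook word. *)
  have [k pk] := iter_shift_head o lp.
  have [||s vs ws] := @rook_word_surj n (iter k Defs.shift p).
  + exact: letters_iter.
  + by move=> i i0; have -> : i = o by apply: val_inj; rewrite /= o0 i0.
  exists (rooks s); first exact: rooks_maximal.
  have [pa [m am]] := alphaP (rook_word_letters vs).
  (* Both parking functions lie in the same shift orbit, which contains only one. *)
  by move: pa; rewrite am ws -iterD; exact: cycle_unique.
Qed.

End Alpha.

Theorem theorem5p1 (R : realType) (n : nat) (hn : (1 <= n)%N) :
  (forall rho : {set square n}, maximal_rook_placement rho ->
     parking (alpha rho)) /\
  set_bij (regions (Ish R n)) (regions (Shi R n))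
    (fun D => omega (alpha (ish_rooks D))).
Proof.
have o0 : Ordinal hn = 0%N :> nat by [].
split; first by move=> rho /maximal_rooks[s vs ->]; have [] := alphaP (rook_word_letters vs).
have bij := set_bij_comp (ish_rooks_bij (R := R) o0) (alpha_bij o0).
exact: set_bij_comp bij (omega_bij hn).
Qed.
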